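(* Let $A$ be a Banach $*$-algebra possessing a bounded one-sided approximate unit. Then every positive linear functional $\varphi$ on $A$ has finite variation, i.e. there exists $\gamma\ge0$ with $|\varphi(a)|^2\le\gamma\,\varphi(a^*a)$ for all $a\in A$, and $\varphi$ is continuous.
   Context: A Banach $*$-algebra is a complete complex algebra with an involution $a\mapsto a^*$ (conjugate linear, $(ab)^*=b^*a^*$, $a^{**}=a$) and a norm with $|ab|\le|a||b|$; the involution need not be continuous. A linear functional $\varphi$ is positive if $\varphi(a^*a)\ge0$ for all $a$. A bounded left (resp. right) approximate unit is a norm-bounded net $(e_i)_{i\in I}$ in $A$ with $e_ia\to a$ (resp. $ae_i\to a$) for all $a\in A$; a bounded one-sided approximate unit is a bounded left or a bounded right approximate unit. *)

(* Defs.v *)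
From Stdlib Require Import Reals.
Open Scope R_scope.

Record Cplx : Type := mkC { Re : R; Im : R }.

Definition C0  : Cplx := mkC 0 0.
Definition C1  : Cplx := mkC 1 0.
Definition Cadd (z w : Cplx)  : Cplx := mkC (Re z + Re w) (Im z + Im w).
Definition Cmul (z w : Cplx)  : Cplx :=
  mkC (Re z * Re w - Im z * Im w) (Re z * Im w + Im z * Re w).
Definition Copp (z : Cplx)  : Cplx := mkC (- Re z) (- Im z).
Definition Cconj (z : Cplx)  : Cplx := mkC (Re z) (- Im z).
Definition Cmod (z : Cplx) : R := sqrt (Re z * Re z + Im z * Im z).

(** * Banach *-algebras (complex, not necessarily unital; the involution need
    not be continuous). *)
Record BanachStarAlgebra : Type := {
  carrier :> Type;
  zero : carrier;
  add : carrier -> carrier -> carrier;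
  opp : carrier -> carrier;
  scal : Cplx -> carrier -> carrier;
  mul : carrier -> carrier -> carrier;
  star : carrier -> carrier;
  norm : carrier -> R;
  add_assoc : forall a b c, add a (add b c) = add (add a b) c;
  add_comm : forall a b, add a b = add b a;
  add_zero : forall a, add a zero = a;
  add_opp : forall a, add a (opp a) = zero;
  scal_one : forall a, scal C1 a = a;
  scal_assoc : forall l m a, scal l (scal m a) = scal (Cmul l m) a;
  scal_add_distr : forall l a b, scal l (add a b) = add (scal l a) (scal l b);
  scal_C_distr : forall l m a, scal (Cadd l m) a = add (scal l a) (scal m a);
  mul_assoc : forall a b c, mul a (mul b c) = mul (mul a b) c;
  mul_add_l : forall a b c, mul (add a b) c = add (mul a c) (mul b c);
  mul_add_r : forall a b c, mul a (add b c) = add (mul a b) (mul a c);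
  mul_scal_l : forall l a b, mul (scal l a) b = scal l (mul a b);
  mul_scal_r : forall l a b, mul a (scal l b) = scal l (mul a b);
  norm_nonneg : forall a, 0 <= norm a;
  norm_eq0 : forall a, norm a = 0 -> a = zero;
  norm_triangle : forall a b, norm (add a b) <= norm a + norm b;
  norm_scal : forall l a, norm (scal l a) = Cmod l * norm a;
  norm_mul : forall a b, norm (mul a b) <= norm a * norm b;
  complete : forall u : nat -> carrier,
    (forall eps, eps > 0 -> exists N : nat, forall m n : nat,
        (N <= m)%nat -> (N <= n)%nat -> norm (add (u m) (opp (u n))) < eps) ->
    exists l : carrier, forall eps, eps > 0 -> exists N : nat, forall n : nat,
        (N <= n)%nat -> norm (add (u n) (opp l)) < eps;
  star_add : forall a b, star (add a b) = add (star a) (star b);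
  star_scal : forall l a, star (scal l a) = scal (Cconj l) (star a);
  star_mul : forall a b, star (mul a b) = mul (star b) (star a);
  star_star : forall a, star (star a) = a
}.

Arguments zero {_}.
Arguments add {_} _ _.
Arguments opp {_} _.
Arguments scal {_} _ _.
Arguments mul {_} _ _.
Arguments star {_} _.
Arguments norm {_} _.

Definition sub {A : BanachStarAlgebra} (a b : A) : A := add a (opp b).

Definition linear_functional (A : BanachStarAlgebra) (phi : A -> Cplx) : Prop :=
  (forall a b : A, phi (add a b) = Cadd (phi a) (phi b)) /\
  (forall (l : Cplx) (a : A), phi (scal l a) = Cmul l (phi a)).

Definition positive_functional (A : BanachStarAlgebra) (phi : A -> Cplx) : Prop :=
  forall a : A, Im (phi (mul (star a) a)) = 0 /\ 0 <= Re (phi (mul (star a) a)).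

Definition directed_set (I : Type) (le : I -> I -> Prop) : Prop :=
  inhabited I /\
  (forall i, le i i) /\
  (forall i j k, le i j -> le j k -> le i k) /\
  (forall i j, exists k, le i k /\ le j k).

Definition net_converges (A : BanachStarAlgebra) (I : Type) (le : I -> I -> Prop)
  (x : I -> A) (l : A) : Prop :=
  forall eps, eps > 0 -> exists i0 : I, forall i : I, le i0 i -> norm (sub (x i) l) < eps.

Definition bounded_left_approx_unit (A : BanachStarAlgebra) (I : Type)
  (le : I -> I -> Prop) (e : I -> A) : Prop :=
  directed_set I le /\
  (exists M : R, forall i, norm (e i) <= M) /\
  (forall a : A, net_converges A I le (fun i => mul (e i) a) a).

Definition bounded_right_approx_unit (A : BanachStarAlgebra) (I : Type)
  (le : I -> I -> Prop) (e : I -> A) : Prop :=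
  directed_set I le /\
  (exists M : R, forall i, norm (e i) <= M) /\
  (forall a : A, net_converges A I le (fun i => mul a (e i)) a).

Definition has_bounded_one_sided_approx_unit (A : BanachStarAlgebra) : Prop :=
  exists (I : Type) (le : I -> I -> Prop) (e : I -> A),
    bounded_left_approx_unit A I le e \/ bounded_right_approx_unit A I le e.

Definition finite_variation (A : BanachStarAlgebra) (phi : A -> Cplx) : Prop :=
  exists gamma : R, 0 <= gamma /\
    forall a : A, (Cmod (phi a)) ^ 2 <= gamma * Re (phi (mul (star a) a)).

Definition continuous_functional (A : BanachStarAlgebra) (phi : A -> Cplx) : Prop :=
  forall (a : A) (eps : R), eps > 0 -> exists delta : R, delta > 0 /\
    forall b : A, norm (sub b a) < delta -> Cmod (Cadd (phi b) (Copp (phi a))) < eps.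

(* Main.v *)
(* Ford's square root lemma, valid for discontinuous involutions, makes every positive
   functional psi on a unital Banach star-algebra B induce a representation pi by bounded
   operators, with |pi(t)|^2 <= |t^* t|, on B with the semi-inner product psi(t^* s).  Modulo the
   kernel of pi the involution has closed graph, because |pi(x)|^2 <= |y| |x| whenever y equals
   x^* modulo the kernel; by Baire's theorem it is continuous there, and hence so is pi.

   Now let A have a bounded left approximate unit.  The functionals sending a to phi(c^* a c)
   extend to the unitization and are therefore continuous.  Cohen's construction writes a null
   sequence as x b_n with b_n bounded, so a |-> phi(a b) is continuous for each b, and uniform
   boundedness gives |phi(a b)| <= C |a| phi(b^* b)^(1/2).  Replacing a by the approximate unit
   yields finite variation, and b = a^* yields phi(a a^* ) <= C^2 |a|^2, hence continuity.  The
   right-sided case follows by passing to the opposite algebra. *)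

Require Import Defs.
From Stdlib Require Import Reals Lia List Psatz.
From Stdlib Require Import Classical IndefiniteDescription.
From Coquelicot Require Compactness.
(* Imported again because Reals binds the name [C1]. *)
Require Import Defs.
Import ListNotations.
Open Scope R_scope.

Declare Scope star_scope.
Infix "[+]" := add (at level 50, left associativity) : star_scope.
Infix "[-]" := sub (at level 50, left associativity) : star_scope.
Infix "[*]" := mul (at level 40, left associativity) : star_scope.
Infix "[.]" := scal (at level 35, right associativity) : star_scope.
Open Scope star_scope.

(** The obstacle throughout is that [norm (star a)] is not controlled by [norm a]. What the
    involution does respect is invertibility, so estimates on adjoints go through the spectral
    radius, always in the form that some power [a^(2^k)] has norm below one. That this follows from
    the invertibility of [1 - z a] on the closed disc is proved by compactness and by averaging over
    roots of -1, without complex function theory. Neither the quotient by the kernel of the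
    representation nor a Hilbert space is formed: equality modulo the kernel is the predicate [null]
    on a difference, and operator norms are inequalities between [N (t [*] s)] and [N s]. Cohen's
    construction is run on a whole null sequence because a left factor [x] common to all terms lets
    the Cauchy-Schwarz inequality separate [x] from the bounded factors. *)

Lemma Cplx_ext (z w : Cplx) : Re z = Re w -> Im z = Im w -> z = w.
Proof. destruct z, w; simpl; intros; subst; reflexivity. Qed.

Definition RtoC (r : R) : Cplx := mkC r 0.

Ltac cplx :=
  apply Cplx_ext;
  cbn [Re Im Cadd Cmul Copp Cconj C0 C1 RtoC]; first [ring | field | lra | nra].

(** * Elementary consequences of the algebra axioms *)

Lemma zero_unique {B : BanachStarAlgebra} (a : B) : a [+] a = a -> a = zero.
Proof.
  intros H. rewrite <- (add_zero _ a) at 1.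
  rewrite <- (add_opp _ a) at 1. rewrite add_assoc, H. apply add_opp.
Qed.

Lemma scal_C0 {B : BanachStarAlgebra} (a : B) : C0 [.] a = zero.
Proof.
  apply zero_unique. rewrite <- scal_C_distr. f_equal. cplx.
Qed.

Lemma scal_zero {B : BanachStarAlgebra} (z : Cplx) : z [.] (@zero B) = zero.
Proof. apply zero_unique. rewrite <- scal_add_distr, add_zero. reflexivity. Qed.

Lemma mul_zero_l {B : BanachStarAlgebra} (a : B) : zero [*] a = zero.
Proof. apply zero_unique. rewrite <- mul_add_l, add_zero. reflexivity. Qed.

Lemma mul_zero_r {B : BanachStarAlgebra} (a : B) : a [*] zero = zero.
Proof. apply zero_unique. rewrite <- mul_add_r, add_zero. reflexivity. Qed.

Lemma zero_add {B : BanachStarAlgebra} (a : B) : zero [+] a = a.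
Proof. rewrite add_comm. apply add_zero. Qed.

Lemma opp_scal {B : BanachStarAlgebra} (a : B) : opp a = Copp C1 [.] a.
Proof.
  rewrite <- (add_zero _ (Copp C1 [.] a)), <- (add_opp _ a), add_assoc.
  rewrite <- (scal_one _ a) at 3. rewrite <- scal_C_distr.
  replace (Cadd (Copp C1) C1) with C0 by cplx.
  rewrite scal_C0. symmetry. apply zero_add.
Qed.

Lemma sub_diag {B : BanachStarAlgebra} (a : B) : a [-] a = zero.
Proof. apply add_opp. Qed.

Lemma sub_eq0 {B : BanachStarAlgebra} (a b : B) : a [-] b = zero -> a = b.
Proof.
  intros H. rewrite <- (add_zero _ a), <- (add_opp _ b), (add_comm _ b), add_assoc.
  unfold sub in H. rewrite H. apply zero_add.
Qed.

Definition is_one {B : BanachStarAlgebra} (e : B) : Prop :=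
  (forall a, e [*] a = a) /\ (forall a, a [*] e = a).

(** * A decision procedure for identities in noncommutative algebras *)

Inductive expr : Type :=
| EVar (n : nat) | EOne | EZero
| EAdd (x y : expr) | EOpp (x : expr) | EScal (z : Cplx) (x : expr) | EMul (x y : expr).

Fixpoint eval {B : BanachStarAlgebra} (e : B) (env : list B) (x : expr) : B :=
  match x with
  | EVar n => nth n env zero
  | EOne => e
  | EZero => zero
  | EAdd x y => eval e env x [+] eval e env y
  | EOpp x => opp (eval e env x)
  | EScal z x => z [.] eval e env x
  | EMul x y => eval e env x [*] eval e env y
  end.

Definition poly := list (Cplx * list nat).

Fixpoint expand (x : expr) : poly :=
  match x with
  | EVar n => [(C1, [n])]
  | EOne => [(C1, [])]
  | EZero => []
  | EAdd x y => expand x ++ expand y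
  | EOpp x => map (fun m => (Cmul (Copp C1) (fst m), snd m)) (expand x)
  | EScal z x => map (fun m => (Cmul z (fst m), snd m)) (expand x)
  | EMul x y =>
      flat_map (fun m => map (fun m' => (Cmul (fst m) (fst m'), snd m ++ snd m')) (expand y))
        (expand x)
  end.

Fixpoint same_word (v w : list nat) : bool :=
  match v, w with
  | [], [] => true
  | i :: v, j :: w => if Nat.eqb i j then same_word v w else false
  | _, _ => false
  end.

Fixpoint insert (c : Cplx) (w : list nat) (p : poly) : poly :=
  match p with
  | [] => [(c, w)]
  | (d, v) :: p => if same_word w v then (Cadd c d, v) :: p else (d, v) :: insert c w p
  end.

Fixpoint collect (p : poly) : poly :=
  match p with
  | [] => []
  | (c, w) :: p => insert c w (collect p)
  end.

(** A proposition rather than a boolean: coefficients may be symbolic complex numbers, and each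
    resulting equation is left to [cplx]. *)
Fixpoint vanishes (p : poly) : Prop :=
  match p with
  | [] => True
  | (c, _) :: p => c = C0 /\ vanishes p
  end.

(** Without a unit the empty word has no meaning. Expressions free of [EOne] expand into nonempty
    words only, so the expansion is valid for any dummy [e]. *)
Fixpoint one_free (x : expr) : bool :=
  match x with
  | EOne => false
  | EAdd x y | EMul x y => if one_free x then one_free y else false
  | EOpp x | EScal _ x => one_free x
  | _ => true
  end.

(** The separate case of a one-letter word keeps [e] out of the value of every nonempty word. *)
Fixpoint eval_word {B : BanachStarAlgebra} (e : B) (env : list B) (w : list nat) : B :=
  match w with
  | [] => e
  | [n] => nth n env zero
  | n :: w => nth n env zero [*] eval_word e env w
  end.

Fixpoint eval_poly {B : BanachStarAlgebra} (e : B) (env : list B) (p : poly) : B :=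
  match p with
  | [] => zero
  | (c, w) :: p => c [.] eval_word e env w [+] eval_poly e env p
  end.

Section Expand.
Context {B : BanachStarAlgebra} (e : B) (env : list B).

Lemma eval_word_app (v w : list nat) :
  is_one e \/ (v <> [] /\ w <> []) ->
  eval_word e env (v ++ w) = eval_word e env v [*] eval_word e env w.
Proof.
  intros H. induction v as [|n v IH].
  - destruct H as [[Hl _]|[H _]]; [symmetry; apply Hl | congruence].
  - destruct v as [|m v].
    + destruct w as [|k w]; [|reflexivity].
      destruct H as [[_ Hr]|[_ H]]; [symmetry; apply Hr | congruence].
    + change (eval_word e env ((n :: m :: v) ++ w))
        with (nth n env zero [*] eval_word e env ((m :: v) ++ w)).
      rewrite IH; [apply mul_assoc|].
      destruct H as [H|[_ H]]; [left; exact H | right; split; [discriminate | exact H]].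
Qed.

Lemma eval_poly_app (p q : poly) :
  eval_poly e env (p ++ q) = eval_poly e env p [+] eval_poly e env q.
Proof.
  induction p as [|[c w] p IH]; simpl.
  - symmetry; apply zero_add.
  - rewrite IH. apply add_assoc.
Qed.

Lemma eval_poly_scal (z : Cplx) (p : poly) :
  eval_poly e env (map (fun m => (Cmul z (fst m), snd m)) p) = z [.] eval_poly e env p.
Proof.
  induction p as [|[c w] p IH]; simpl.
  - symmetry; apply scal_zero.
  - rewrite IH, scal_add_distr, scal_assoc. reflexivity.
Qed.

Lemma one_free_expand (x : expr) :
  one_free x = true -> forall c w, In (c, w) (expand x) -> w <> [].
Proof.
  induction x; simpl; intros H c w Hin.
  - destruct Hin as [Hin|[]]. injection Hin; intros; subst; discriminate.
  - discriminate.
  - destruct Hin.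
  - destruct (one_free x1); [|discriminate].
    apply in_app_or in Hin. destruct Hin; eauto.
  - apply in_map_iff in Hin. destruct Hin as [[d v] [E Hin]].
    injection E; intros; subst. eauto.
  - apply in_map_iff in Hin. destruct Hin as [[d v] [E Hin]].
    injection E; intros; subst. eauto.
  - destruct (one_free x1); [|discriminate].
    apply in_flat_map in Hin. destruct Hin as [[d v] [H1 Hin]].
    apply in_map_iff in Hin. destruct Hin as [[d' v'] [E H2]].
    simpl in E. injection E; intros; subst.
    intros E'. apply app_eq_nil in E'. destruct E' as [E' _]. revert E'. eapply IHx1; eauto.
Qed.

Lemma eval_poly_mul (p q : poly) :
  is_one e \/ (forall c w, In (c, w) (p ++ q) -> w <> []) ->
  eval_poly e env
    (flat_map (fun m => map (fun m' => (Cmul (fst m) (fst m'), snd m ++ snd m')) q) p)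
  = eval_poly e env p [*] eval_poly e env q.
Proof.
  intros H. induction p as [|[c v] p IH]; simpl.
  - symmetry; apply mul_zero_l.
  - rewrite eval_poly_app, IH, mul_add_l.
    2:{ destruct H as [H|H]; [left; exact H|right; intros; eapply H; right; eauto]. }
    f_equal. clear IH. induction q as [|[d w] q IH]; simpl.
    + symmetry; apply mul_zero_r.
    + rewrite IH, mul_add_r, !mul_scal_l, mul_scal_r, scal_assoc.
      2:{ destruct H as [H|H]; [left; exact H|right; intros c' w' [Hin|Hin]].
          - apply (H c' w'). left. exact Hin.
          - apply in_app_or in Hin. apply (H c' w'). right. apply in_or_app.
            destruct Hin; [left; assumption | right; right; assumption]. }
      f_equal. f_equal. apply eval_word_app.
      destruct H as [H|H]; [left; exact H|right].
      split; [apply (H c v); left; reflexivity|].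
      apply (H d w). right. apply in_or_app. right. left. reflexivity.
Qed.

Lemma eval_expand (x : expr) :
  is_one e \/ one_free x = true -> eval e env x = eval_poly e env (expand x).
Proof.
  induction x; simpl; intros H.
  - rewrite scal_one, add_zero. reflexivity.
  - rewrite scal_one, add_zero. reflexivity.
  - reflexivity.
  - rewrite eval_poly_app, IHx1, IHx2; [reflexivity|..];
      (destruct H as [H|H]; [left; exact H|right; destruct (one_free x1); auto; discriminate]).
  - rewrite eval_poly_scal, opp_scal, IHx; auto.
  - rewrite eval_poly_scal, IHx; auto.
  - rewrite IHx1, IHx2 by
      (destruct H as [H|H]; [left; exact H|right; destruct (one_free x1); auto; discriminate]).
    symmetry. apply eval_poly_mul.
    destruct H as [H|H]; [left; exact H|right].
    destruct (one_free x1) eqn:E1; [|discriminate].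
    intros c w Hin. apply in_app_or in Hin.
    destruct Hin as [Hin|Hin]; [exact (one_free_expand x1 E1 c w Hin) | exact (one_free_expand x2 H c w Hin)].
Qed.

Lemma same_word_eq (v w : list nat) : same_word v w = true -> v = w.
Proof.
  revert w; induction v as [|i v IH]; intros [|j w]; simpl; try discriminate; auto.
  destruct (Nat.eqb i j) eqn:E; [|discriminate].
  intros H. apply PeanoNat.Nat.eqb_eq in E. f_equal; auto.
Qed.

Lemma eval_insert (c : Cplx) (w : list nat) (p : poly) :
  eval_poly e env (insert c w p) = c [.] eval_word e env w [+] eval_poly e env p.
Proof.
  induction p as [|[d v] p IH]; simpl; [reflexivity|].
  destruct (same_word w v) eqn:E; simpl.
  - apply same_word_eq in E. subst. rewrite scal_C_distr, <- add_assoc. reflexivity.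
  - rewrite IH, !add_assoc, (add_comm _ (d [.] _)). reflexivity.
Qed.

Lemma eval_collect (p : poly) : eval_poly e env (collect p) = eval_poly e env p.
Proof.
  induction p as [|[c w] p IH]; simpl; [reflexivity|].
  rewrite eval_insert, IH. reflexivity.
Qed.

Lemma eval_vanishes (p : poly) : vanishes p -> eval_poly e env p = zero.
Proof.
  induction p as [|[c w] p IH]; simpl; [reflexivity|].
  intros [-> H]. rewrite IH, scal_C0 by exact H. apply add_zero.
Qed.

Lemma eval_eq (x y : expr) :
  is_one e \/ one_free (EAdd x (EOpp y)) = true ->
  vanishes (collect (expand (EAdd x (EOpp y)))) ->
  eval e env x = eval e env y.
Proof.
  intros H Hv. apply sub_eq0.
  change (eval e env x [-] eval e env y) with (eval e env (EAdd x (EOpp y))).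
  rewrite eval_expand, <- eval_collect by exact H. apply eval_vanishes. exact Hv.
Qed.

End Expand.

Ltac alg_mem x l :=
  lazymatch l with
  | x :: _ => constr:(true)
  | _ :: ?l => alg_mem x l
  | _ => constr:(false)
  end.

Ltac alg_index x l :=
  lazymatch l with
  | x :: _ => constr:(O)
  | _ :: ?l => let n := alg_index x l in constr:(S n)
  end.

Ltac alg_atoms e l t :=
  lazymatch t with
  | e => l
  | zero => l
  | ?x [+] ?y => let l := alg_atoms e l x in alg_atoms e l y
  | ?x [-] ?y => let l := alg_atoms e l x in alg_atoms e l y
  | ?x [*] ?y => let l := alg_atoms e l x in alg_atoms e l y
  | opp ?x => alg_atoms e l x
  | _ [.] ?x => alg_atoms e l x
  | _ => lazymatch alg_mem t l with true => l | false => constr:(t :: l) end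
  end.

Ltac alg_reify e l t :=
  lazymatch t with
  | e => constr:(EOne)
  | zero => constr:(EZero)
  | ?x [+] ?y => let x := alg_reify e l x in let y := alg_reify e l y in constr:(EAdd x y)
  | ?x [-] ?y => let x := alg_reify e l x in let y := alg_reify e l y in constr:(EAdd x (EOpp y))
  | ?x [*] ?y => let x := alg_reify e l x in let y := alg_reify e l y in constr:(EMul x y)
  | opp ?x => let x := alg_reify e l x in constr:(EOpp x)
  | ?z [.] ?x => let x := alg_reify e l x in constr:(EScal z x)
  | _ => let n := alg_index t l in constr:(EVar n)
  end.

Ltac alg_core B e side :=
  lazymatch goal with
  | |- ?a = ?b =>
      let l := alg_atoms e (@nil (carrier B)) a in
      let l := alg_atoms e l b in
      let x := alg_reify e l a in
      let y := alg_reify e l b in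
      change (eval e l x = eval e l y);
      apply eval_eq;
      [ side
      | cbv [expand collect insert same_word vanishes map flat_map app fst snd Nat.eqb];
        repeat split; cplx ]
  end.

(* The unit of the reified expressions is a dummy: any term not occurring in the goal. *)
Ltac alg :=
  lazymatch goal with
  | |- @eq (carrier ?B) _ _ => alg_core B (@opp B (opp zero)) ltac:(right; reflexivity)
  | |- @eq ?T _ _ => let T' := eval hnf in T in fail "alg" T'
  end.

Ltac algu H :=
  lazymatch type of H with
  | @is_one ?B ?e => alg_core B e ltac:(left; exact H)
  end.

(** * Norm estimates and limits *)

Lemma Cmod_nonneg (z : Cplx) : 0 <= Cmod z.
Proof. apply sqrt_pos. Qed.

Lemma Cmod_sqr (z : Cplx) : Cmod z * Cmod z = Re z * Re z + Im z * Im z.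
Proof. apply sqrt_sqrt. nra. Qed.

Lemma Cmod_unique (z : Cplx) (r : R) :
  0 <= r -> r * r = Re z * Re z + Im z * Im z -> Cmod z = r.
Proof.
  intros Hr H. pose proof (Cmod_nonneg z). pose proof (Cmod_sqr z). nra.
Qed.

Lemma Cmod_RtoC (r : R) : Cmod (RtoC r) = Rabs r.
Proof.
  apply Cmod_unique; [apply Rabs_pos|]. simpl.
  unfold Rabs. destruct (Rcase_abs r); ring.
Qed.

Lemma Cmod_C0 : Cmod C0 = 0.
Proof. apply Cmod_unique; simpl; lra. Qed.

Lemma Cmod_eq0 (z : Cplx) : Cmod z = 0 -> z = C0.
Proof.
  intros H. pose proof (Cmod_sqr z). rewrite H in *.
  apply Cplx_ext; simpl; nra.
Qed.

Lemma Cmod_mul (z w : Cplx) : Cmod (Cmul z w) = Cmod z * Cmod w.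
Proof.
  apply Cmod_unique.
  - apply Rmult_le_pos; apply Cmod_nonneg.
  - transitivity ((Cmod z * Cmod z) * (Cmod w * Cmod w)); [ring|].
    rewrite !Cmod_sqr. simpl. ring.
Qed.

Lemma Cmod_conj (z : Cplx) : Cmod (Cconj z) = Cmod z.
Proof.
  apply Cmod_unique; [apply Cmod_nonneg|]. rewrite Cmod_sqr. simpl. ring.
Qed.

Lemma Cmod_add (z w : Cplx) : Cmod (Cadd z w) <= Cmod z + Cmod w.
Proof.
  pose proof (Cmod_nonneg z). pose proof (Cmod_nonneg w).
  pose proof (Cmod_sqr z) as Hz. pose proof (Cmod_sqr w) as Hw.
  pose proof (Cmod_nonneg (Cadd z w)). pose proof (Cmod_sqr (Cadd z w)) as Hs.
  simpl in Hs.
  assert (Hcs : Re z * Re w + Im z * Im w <= Cmod z * Cmod w).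
  { assert (0 <= Cmod z * Cmod w) by (apply Rmult_le_pos; assumption).
    assert ((Cmod z * Cmod w) * (Cmod z * Cmod w)
            = (Re z * Re z + Im z * Im z) * (Re w * Re w + Im w * Im w))
      by (rewrite <- Hz, <- Hw; ring).
    (* Lagrange's identity: this square is the defect in the Cauchy-Schwarz inequality of the
       plane. *)
    assert (0 <= (Re z * Im w - Im z * Re w) * (Re z * Im w - Im z * Re w))
      by apply Rle_0_sqr.
    apply Rsqr_incr_0_var; [unfold Rsqr|assumption]. nra. }
  nra.
Qed.

Lemma Re_le_Cmod (z : Cplx) : Rabs (Re z) <= Cmod z.
Proof.
  pose proof (Cmod_nonneg z). pose proof (Cmod_sqr z).
  unfold Rabs; destruct (Rcase_abs (Re z)); nra.
Qed.

Lemma Im_le_Cmod (z : Cplx) : Rabs (Im z) <= Cmod z.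
Proof.
  pose proof (Cmod_nonneg z). pose proof (Cmod_sqr z).
  unfold Rabs; destruct (Rcase_abs (Im z)); nra.
Qed.

Lemma Cmod_le_Re_Im (z : Cplx) : Cmod z <= Rabs (Re z) + Rabs (Im z).
Proof.
  pose proof (Cmod_nonneg z). pose proof (Cmod_sqr z).
  pose proof (Rabs_pos (Re z)). pose proof (Rabs_pos (Im z)).
  pose proof (Rsqr_abs (Re z)). pose proof (Rsqr_abs (Im z)). unfold Rsqr in *.
  assert (0 <= Rabs (Re z) * Rabs (Im z)) by (apply Rmult_le_pos; assumption).
  nra.
Qed.

Section Norm.
Context {B : BanachStarAlgebra}.
Implicit Types a b c : B.

Lemma norm_zero : norm (@zero B) = 0.
Proof. rewrite <- (scal_C0 zero), norm_scal, Cmod_C0. ring. Qed.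

Lemma norm_scal_R (r : R) a : norm (RtoC r [.] a) = Rabs r * norm a.
Proof. rewrite norm_scal, Cmod_RtoC. reflexivity. Qed.

Lemma norm_opp a : norm (opp a) = norm a.
Proof.
  rewrite opp_scal, norm_scal.
  rewrite (Cmod_unique (Copp C1) 1); [ring|lra|simpl; ring].
Qed.

Lemma norm_sub_sym a b : norm (a [-] b) = norm (b [-] a).
Proof. rewrite <- norm_opp. f_equal. alg. Qed.

Lemma norm_sub_le a b : norm (a [-] b) <= norm a + norm b.
Proof. rewrite <- (norm_opp b). apply norm_triangle. Qed.

Lemma norm_sub_triangle b a c : norm (a [-] c) <= norm (a [-] b) + norm (b [-] c).
Proof.
  replace (a [-] c) with ((a [-] b) [+] (b [-] c)) by alg. apply norm_triangle.
Qed.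

Lemma norm_le_sub a b : norm a <= norm b + norm (a [-] b).
Proof.
  replace a with (b [+] (a [-] b)) at 1 by alg. apply norm_triangle.
Qed.

Lemma pow_eventually_small (C rho eps : R) :
  0 <= C -> 0 <= rho < 1 -> 0 < eps ->
  exists N : nat, forall n, (N <= n)%nat -> C * rho ^ n < eps.
Proof.
  intros HC Hr He.
  destruct (pow_lt_1_zero rho) with (y := eps / (C + 1)) as [N HN].
  - rewrite Rabs_right; lra.
  - apply Rdiv_lt_0_compat; lra.
  - exists N. intros n Hn. specialize (HN n Hn).
    assert (0 <= rho ^ n) by (apply pow_le; lra).
    rewrite Rabs_right in HN by lra.
    apply (Rmult_lt_compat_l (C + 1)) in HN; [|lra].
    replace ((C + 1) * (eps / (C + 1))) with eps in HN by (field; lra).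
    lra.
Qed.

(** Replaces passage to the limit: an identity satisfied by the limit of a geometrically convergent
    sequence is proved by bounding the norm of the difference of its sides by [C * rho ^ n]. *)
Lemma le_pow_le0 (x C rho : R) :
  0 <= C -> 0 <= rho < 1 -> (forall n : nat, x <= C * rho ^ n) -> x <= 0.
Proof.
  intros HC Hr H. destruct (Rle_lt_dec x 0) as [|Hx]; [assumption|].
  destruct (pow_eventually_small C rho x HC Hr Hx) as [N HN].
  specialize (H N). specialize (HN N (le_n N)). lra.
Qed.

Lemma norm_le0_eq a b : norm (a [-] b) <= 0 -> a = b.
Proof.
  intros H. apply sub_eq0, norm_eq0. pose proof (norm_nonneg _ (a [-] b)). lra.
Qed.

Lemma geometric_dist (u : nat -> B) (C rho : R) :
  0 <= rho < 1 -> 0 <= C ->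
  (forall n, norm (u (S n) [-] u n) <= C * rho ^ n) ->
  forall n k, norm (u (n + k)%nat [-] u n) <= C / (1 - rho) * rho ^ n.
Proof.
  intros Hr HC Hu n k.
  (* The bound to be proved is not inductive; the partial geometric sum is. *)
  assert (H : norm (u (n + k)%nat [-] u n) <= C / (1 - rho) * (rho ^ n - rho ^ (n + k))).
  { induction k as [|k IH].
    - rewrite PeanoNat.Nat.add_0_r, sub_diag, norm_zero. lra.
    - rewrite PeanoNat.Nat.add_succ_r.
      eapply Rle_trans; [apply (norm_sub_triangle (u (n + k)%nat))|].
      specialize (Hu (n + k)%nat).
      replace (C * rho ^ (n + k)) with (C / (1 - rho) * (rho ^ (n + k) - rho ^ S (n + k)))
        in Hu by (simpl; field; lra).
      lra. }
  assert (0 <= rho ^ (n + k)) by (apply pow_le; lra).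
  assert (0 <= C / (1 - rho)) by (apply Rle_mult_inv_pos; lra).
  nra.
Qed.

Lemma geometric_limit (u : nat -> B) (C rho : R) :
  0 <= rho < 1 -> 0 <= C ->
  (forall n, norm (u (S n) [-] u n) <= C * rho ^ n) ->
  exists l, forall n, norm (u n [-] l) <= C / (1 - rho) * rho ^ n.
Proof.
  intros Hr HC Hu.
  pose proof (geometric_dist u C rho Hr HC Hu) as Hd.
  assert (HK : 0 <= C / (1 - rho)) by (apply Rle_mult_inv_pos; lra).
  set (K := C / (1 - rho)) in *.
  destruct (complete B u) as [l Hl].
  { intros eps He.
    destruct (pow_eventually_small K rho (eps / 2) HK Hr ltac:(lra)) as [N HN].
    exists N. intros m n Hm Hn. change (norm (u m [-] u n) < eps).
    eapply Rle_lt_trans; [apply (norm_sub_triangle (u N))|].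
    rewrite (norm_sub_sym (u N)).
    pose proof (Hd N (m - N)%nat) as H1. pose proof (Hd N (n - N)%nat) as H2.
    replace (N + (m - N))%nat with m in H1 by lia.
    replace (N + (n - N))%nat with n in H2 by lia.
    specialize (HN N (le_n N)). lra. }
  exists l. intros n. apply Rnot_lt_le. intros H.
  destruct (Hl (norm (u n [-] l) - K * rho ^ n) ltac:(lra)) as [N HN].
  specialize (HN (n + N)%nat ltac:(lia)).
  change (norm (u (n + N)%nat [-] l) < norm (u n [-] l) - K * rho ^ n) in HN.
  pose proof (norm_sub_triangle (u (n + N)%nat) (u n) l) as Ht.
  rewrite (norm_sub_sym (u n) (u (n + N)%nat)) in Ht. specialize (Hd n N). lra.
Qed.

(** Stated for arbitrary sets: some [V n] is dense in a ball. What replaces closedness is supplied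
    at each use. *)
Lemma baire (V : nat -> B -> Prop) :
  (forall a, exists n, V n a) ->
  exists n x r, 0 < r /\
    forall y, norm (y [-] x) < r -> forall eps, 0 < eps ->
    exists v, V n v /\ norm (y [-] v) < eps.
Proof.
  intros Hcover. apply NNPP. intros Hno.
  (* If no [V n] is dense in a ball, every ball contains one of some radius [d] whose centre has
     distance at least [2 d] from [V n]. The factor 2 keeps [V n] away from the closed ball too,
     where the limit of the centres lies. *)
  assert (Hstep : forall nxr : nat * B * R, exists yd : B * R,
    let '(n, x, r) := nxr in
    0 < r -> 0 < snd yd <= r / 2 /\ norm (fst yd [-] x) + snd yd < r /\
             forall v, V n v -> 2 * snd yd <= norm (fst yd [-] v)).
  { intros [[n x] r]. destruct (Rlt_le_dec 0 r) as [Hr|Hr];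
      [|exists (x, r); intros; lra].
    apply NNPP. intros Hc. apply Hno. exists n, x, r. split; [exact Hr|].
    intros y Hy eps He. apply NNPP. intros Hv. apply Hc.
    exists (y, Rmin (eps / 2) ((r - norm (y [-] x)) / 2)). intros _. cbn [fst snd].
    pose proof (norm_nonneg _ (y [-] x)).
    pose proof (Rmin_l (eps / 2) ((r - norm (y [-] x)) / 2)).
    pose proof (Rmin_r (eps / 2) ((r - norm (y [-] x)) / 2)).
    repeat split; [apply Rmin_glb_lt; lra|lra|lra|].
    intros v Hvn. apply Rnot_lt_le. intros Hlt. apply Hv. exists v.
    split; [exact Hvn|lra]. }
  apply functional_choice in Hstep. destruct Hstep as [f Hf].
  pose (ball := fix ball n := match n with
    | O => (zero, 1) | S n => f (n, fst (ball n), snd (ball n)) end : B * R).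
  set (x := fun n => fst (ball n)). set (r := fun n => snd (ball n)).
  assert (Hr : forall n, 0 < r n).
  { induction n as [|n IH]; [unfold r; simpl; lra|].
    apply (Hf (n, x n, r n) IH). }
  assert (Hs : forall n, r (S n) <= r n / 2 /\ norm (x (S n) [-] x n) + r (S n) < r n /\
     forall v, V n v -> 2 * r (S n) <= norm (x (S n) [-] v)).
  { intros n. destruct (Hf (n, x n, r n) (Hr n)) as [H1 [H2 H3]].
    split; [apply H1 | split; [exact H2 | exact H3]]. }
  assert (Hr2 : forall n, r n <= (/2) ^ n).
  { induction n as [|n IH]; [unfold r; simpl; lra|].
    destruct (Hs n) as [H _]. simpl. lra. }
  destruct (geometric_limit x 1 (/2)) as [l Hl]; [lra|lra| |].
  { intros n. destruct (Hs n) as [_ [H _]]. specialize (Hr2 n).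
    pose proof (Hr (S n)). lra. }
  assert (Hball : forall n k, norm (x (n + k)%nat [-] x n) + r (n + k)%nat <= r n).
  { intros n k. induction k as [|k IH].
    - rewrite PeanoNat.Nat.add_0_r, sub_diag, norm_zero. lra.
    - rewrite PeanoNat.Nat.add_succ_r. destruct (Hs (n + k)%nat) as [_ [H _]].
      pose proof (norm_sub_triangle (x (n + k)%nat) (x (S (n + k))) (x n)). lra. }
  assert (Hlim : forall n, norm (l [-] x n) <= r n).
  { intros n. assert (norm (l [-] x n) - r n <= 0); [|lra].
    apply (le_pow_le0 _ (1 / (1 - /2)) (/2)); [lra|lra|]. intros k.
    pose proof (Hl (n + k)%nat) as H1. pose proof (Hball n k) as H2.
    pose proof (norm_sub_triangle (x (n + k)%nat) l (x n)) as H3.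
    rewrite (norm_sub_sym l (x (n + k)%nat)) in H3.
    pose proof (Hr (n + k)%nat).
    assert ((/2) ^ (n + k) <= (/2) ^ k).
    { rewrite pow_add. assert (0 <= (/2) ^ k) by (apply pow_le; lra).
      assert ((/2) ^ n <= 1) by (rewrite <- (pow1 n); apply pow_incr; lra). nra. }
    nra. }
  destruct (Hcover l) as [n Hn].
  destruct (Hs n) as [_ [_ H]]. specialize (H l Hn).
  specialize (Hlim (S n)). rewrite norm_sub_sym in Hlim. pose proof (Hr (S n)). lra.
Qed.

Lemma star_opp a : star (opp a) = opp (star a).
Proof.
  rewrite !opp_scal, star_scal. f_equal. cplx.
Qed.

Lemma star_sub a b : star (a [-] b) = star a [-] star b.
Proof. unfold sub. rewrite star_add, star_opp. reflexivity. Qed.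

Lemma star_one (e : B) : is_one e -> star e = e.
Proof.
  intros [Hl Hr]. rewrite <- (star_star _ e) at 2.
  rewrite <- (Hr (star e)), star_mul, star_star, Hr. reflexivity.
Qed.

End Norm.

(** * Unitization and opposite algebra *)

Section Unitization.
Context (A : BanachStarAlgebra).

Definition un_add (s t : Cplx * A) := (Cadd (fst s) (fst t), snd s [+] snd t).
Definition un_opp (s : Cplx * A) := (Copp (fst s), opp (snd s)).
Definition un_scal z (s : Cplx * A) := (Cmul z (fst s), z [.] snd s).
Definition un_mul (s t : Cplx * A) :=
  (Cmul (fst s) (fst t), fst s [.] snd t [+] fst t [.] snd s [+] snd s [*] snd t).
Definition un_star (s : Cplx * A) := (Cconj (fst s), star (snd s)).
Definition un_norm (s : Cplx * A) := Cmod (fst s) + norm (snd s).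

Lemma un_complete (u : nat -> Cplx * A) :
  (forall eps, eps > 0 -> exists N : nat, forall m n : nat,
      (N <= m)%nat -> (N <= n)%nat -> un_norm (un_add (u m) (un_opp (u n))) < eps) ->
  exists l, forall eps, eps > 0 -> exists N : nat, forall n : nat,
      (N <= n)%nat -> un_norm (un_add (u n) (un_opp l)) < eps.
Proof.
  intros H.
  assert (Hc : forall (g : Cplx -> R),
    (forall z w, Rabs (g z - g w) <= Cmod (Cadd z (Copp w))) ->
    exists l, Un_cv (fun n => g (fst (u n))) l).
  { intros g Hg. destruct (R_complete (fun n => g (fst (u n)))) as [l Hl]; [|exists l; exact Hl].
    intros eps He. destruct (H eps He) as [N HN]. exists N. intros m n Hm Hn.
    unfold Rdist. specialize (HN m n Hm Hn). unfold un_norm in HN. simpl in HN.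
    specialize (Hg (fst (u m)) (fst (u n))).
    pose proof (norm_nonneg _ (snd (u m) [+] opp (snd (u n)))). lra. }
  destruct (Hc Re) as [x Hx].
  { intros z w. apply (Re_le_Cmod (Cadd z (Copp w))). }
  destruct (Hc Im) as [y Hy].
  { intros z w. apply (Im_le_Cmod (Cadd z (Copp w))). }
  destruct (complete A (fun n => snd (u n))) as [l Hl].
  { intros eps He. destruct (H eps He) as [N HN]. exists N. intros m n Hm Hn.
    specialize (HN m n Hm Hn). unfold un_norm in HN. simpl in HN.
    pose proof (Cmod_nonneg (Cadd (fst (u m)) (Copp (fst (u n))))). lra. }
  exists (mkC x y, l). intros eps He.
  destruct (Hx (eps / 3) ltac:(lra)) as [N1 H1].
  destruct (Hy (eps / 3) ltac:(lra)) as [N2 H2].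
  destruct (Hl (eps / 3) ltac:(lra)) as [N3 H3].
  exists (N1 + N2 + N3)%nat. intros n Hn.
  specialize (H1 n ltac:(lia)). specialize (H2 n ltac:(lia)). specialize (H3 n ltac:(lia)).
  unfold Rdist in *. unfold un_norm. simpl.
  pose proof (Cmod_le_Re_Im (Cadd (fst (u n)) (Copp (mkC x y)))) as H4. simpl in H4.
  unfold Rminus in *. lra.
Qed.

Definition unitization : BanachStarAlgebra.
Proof.
  refine {| carrier := Cplx * A; zero := (C0, zero); add := un_add; opp := un_opp;
    scal := un_scal; mul := un_mul; star := un_star; norm := un_norm;
    complete := un_complete |};
  unfold un_add, un_opp, un_scal, un_mul, un_star, un_norm; intros; cbn [fst snd].
  - f_equal; [cplx|alg].
  - f_equal; [cplx|alg].
  - destruct a; f_equal; cbn [fst snd]; [cplx|alg].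
  - f_equal; [cplx|alg].
  - destruct a; f_equal; cbn [fst snd]; [cplx|alg].
  - f_equal; [cplx|alg].
  - f_equal; [cplx|alg].
  - f_equal; [cplx|alg].
  - f_equal; [cplx|alg].
  - f_equal; [cplx|alg].
  - f_equal; [cplx|alg].
  - f_equal; [cplx|alg].
  - f_equal; [cplx|alg].
  - pose proof (Cmod_nonneg (fst a)). pose proof (norm_nonneg _ (snd a)). lra.
  - pose proof (Cmod_nonneg (fst a)). pose proof (norm_nonneg _ (snd a)).
    destruct a as [z a]; cbn [fst snd] in *.
    rewrite (Cmod_eq0 z), (norm_eq0 _ a) by lra. reflexivity.
  - pose proof (Cmod_add (fst a) (fst b)). pose proof (norm_triangle _ (snd a) (snd b)). lra.
  - rewrite Cmod_mul, norm_scal. ring.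
  - rewrite Cmod_mul.
    pose proof (norm_triangle _ (fst a [.] snd b [+] fst b [.] snd a) (snd a [*] snd b)).
    pose proof (norm_triangle _ (fst a [.] snd b) (fst b [.] snd a)).
    pose proof (norm_mul _ (snd a) (snd b)). rewrite !norm_scal in *. lra.
  - rewrite star_add. f_equal. cplx.
  - rewrite star_scal. f_equal. cplx.
  - rewrite !star_add, !star_scal, star_mul. f_equal; [cplx|alg].
  - destruct a; cbn [fst snd]. rewrite star_star. f_equal. cplx.
Defined.

Definition un_one : unitization := (C1, zero).

Lemma un_one_is_one : is_one un_one.
Proof.
  split; intros [z a]; simpl; unfold un_mul, un_one; cbn [fst snd]; (f_equal; [cplx|alg]).
Qed.

Lemma norm_un_one : norm un_one = 1.
Proof.
  simpl. unfold un_norm, un_one; simpl. rewrite norm_zero, (Cmod_unique C1 1); simpl; lra.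
Qed.

Definition embed (a : A) : unitization := (C0, a).

(** [A] is an ideal of its unitization, so the unitization acts on it by left multiplication.
    Through this action [t |-> phi (star b [*] act t b)] makes sense on the whole unitization. *)
Definition act (t : unitization) (c : A) : A := fst t [.] c [+] snd t [*] c.

Lemma act_mul (s t : unitization) (c : A) : act (s [*] t) c = act s (act t c).
Proof. destruct s, t. unfold act; simpl. alg. Qed.

Lemma act_add (s t : unitization) (c : A) : act (s [+] t) c = act s c [+] act t c.
Proof. destruct s, t. unfold act; simpl. alg. Qed.

Lemma act_sub (s t : unitization) (c : A) : act (s [-] t) c = act s c [-] act t c.
Proof. destruct s, t. unfold act; simpl. alg. Qed.

Lemma act_scal (z : Cplx) (t : unitization) (c : A) : act (z [.] t) c = z [.] act t c.
Proof. destruct t. unfold act; simpl. alg. Qed.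

Lemma act_one (c : A) : act un_one c = c.
Proof. unfold act; simpl. alg. Qed.

Lemma act_embed (a c : A) : act (embed a) c = a [*] c.
Proof. unfold act; simpl. alg. Qed.

(** The action respects adjoints; this is what makes [t |-> phi (star b [*] act t b)] positive. *)
Lemma act_star (t : unitization) (c d : A) :
  star d [*] act t c = star (act (star t) d) [*] c.
Proof.
  destruct t as [z a]. unfold act; simpl.
  rewrite star_add, star_scal, star_mul, star_star.
  replace (Cconj (Cconj z)) with z by cplx. alg.
Qed.

Lemma norm_act (t : unitization) (c : A) : norm (act t c) <= norm t * norm c.
Proof.
  destruct t as [z a]. unfold act; simpl. unfold un_norm; simpl.
  pose proof (norm_triangle _ (z [.] c) (a [*] c)). pose proof (norm_mul _ a c).
  rewrite norm_scal in *. lra.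
Qed.

End Unitization.

Arguments embed {A} _.
Arguments act {A} _ _.
Arguments un_one {A}.

Definition opposite (A : BanachStarAlgebra) : BanachStarAlgebra.
Proof.
  refine {| carrier := A; zero := zero; add := add; opp := opp; scal := scal;
    mul := fun a b => b [*] a; star := star; norm := norm; complete := complete A |};
  intros.
  - apply add_assoc.
  - apply add_comm.
  - apply add_zero.
  - apply add_opp.
  - apply scal_one.
  - apply scal_assoc.
  - apply scal_add_distr.
  - apply scal_C_distr.
  - symmetry. apply mul_assoc.
  - apply mul_add_r.
  - apply mul_add_l.
  - apply mul_scal_r.
  - apply mul_scal_l.
  - apply norm_nonneg.
  - apply norm_eq0. assumption.
  - apply norm_triangle.
  - apply norm_scal.
  - rewrite Rmult_comm. apply norm_mul.
  - apply star_add.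
  - apply star_scal.
  - apply star_mul.
  - apply star_star.
Defined.

(** * Invertibility and iterated squares *)

Definition is_inverse {B : BanachStarAlgebra} (e t v : B) : Prop :=
  t [*] v = e /\ v [*] t = e.

Definition commute {B : BanachStarAlgebra} (a b : B) : Prop := a [*] b = b [*] a.

(** The power [a^(2^k)]. Spectral radius below one is expressed by [norm (sqpow k a) < 1] for some
    [k]. *)
Fixpoint sqpow {B : BanachStarAlgebra} (k : nat) (a : B) : B :=
  match k with O => a | S k => sqpow k a [*] sqpow k a end.

Fixpoint Csqpow (k : nat) (z : Cplx) : Cplx :=
  match k with O => z | S k => Cmul (Csqpow k z) (Csqpow k z) end.

Section SquarePowers.
Context {B : BanachStarAlgebra}.
Implicit Types a b c : B.

Lemma sqpow_scal (k : nat) (z : Cplx) a : sqpow k (z [.] a) = Csqpow k z [.] sqpow k a.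
Proof. induction k as [|k IH]; simpl; [reflexivity|]. rewrite IH. alg. Qed.

Lemma sqpow_add (j k : nat) a : sqpow (j + k) a = sqpow j (sqpow k a).
Proof. induction j as [|j IH]; simpl; [reflexivity|]. rewrite IH. reflexivity. Qed.

Lemma sqpow_star (k : nat) a : sqpow k (star a) = star (sqpow k a).
Proof. induction k as [|k IH]; simpl; [reflexivity|]. rewrite IH, star_mul. reflexivity. Qed.

(** The exponent could be [2^k]; [S k] already gives the decay to zero that is wanted. *)
Lemma norm_sqpow_le (k : nat) a : norm a <= 1 -> norm (sqpow k a) <= norm a ^ S k.
Proof.
  intros Ha. pose proof (norm_nonneg _ a).
  induction k as [|k IH]; [simpl; lra|].
  change (sqpow (S k) a) with (sqpow k a [*] sqpow k a).
  eapply Rle_trans; [apply norm_mul|]. pose proof (norm_nonneg _ (sqpow k a)).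
  assert (0 <= norm a ^ k) by (apply pow_le; assumption).
  assert (norm a ^ k <= 1) by (rewrite <- (pow1 k); apply pow_incr; lra).
  assert (norm a ^ S k <= norm a) by (simpl; nra).
  change (norm a ^ S (S k)) with (norm a * norm a ^ S k).
  apply Rmult_le_compat; lra.
Qed.

Lemma norm_sqpow_le1 (j k : nat) a :
  (k <= j)%nat -> norm (sqpow k a) <= 1 -> norm (sqpow j a) <= 1.
Proof.
  intros Hk H. replace j with ((j - k) + k)%nat by lia. rewrite sqpow_add.
  eapply Rle_trans; [apply norm_sqpow_le; exact H|].
  rewrite <- (pow1 (S (j - k))). apply pow_incr. split; [apply norm_nonneg | exact H].
Qed.

Lemma commute_sqpow (k : nat) a b : commute a b -> commute a (sqpow k b).
Proof.
  unfold commute. intros H. induction k as [|k IH]; simpl; [exact H|].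
  rewrite mul_assoc, IH, <- mul_assoc, IH, mul_assoc. reflexivity.
Qed.

Lemma commute_limit (u : nat -> B) (l a : B) (K rho : R) :
  0 <= rho < 1 -> 0 <= K -> (forall n, norm (u n [-] l) <= K * rho ^ n) ->
  (forall n, commute (u n) a) -> commute l a.
Proof.
  intros Hr HK Hu Hc. apply norm_le0_eq. pose proof (norm_nonneg _ a).
  apply (le_pow_le0 _ (2 * norm a * K) rho); [nra|exact Hr|]. intros n.
  replace (l [*] a [-] a [*] l) with (a [*] (u n [-] l) [-] (u n [-] l) [*] a).
  2:{ transitivity (a [*] u n [-] u n [*] a [+] (l [*] a [-] a [*] l)); [alg|].
      rewrite (Hc n). alg. }
  eapply Rle_trans; [apply norm_sub_le|].
  pose proof (norm_mul _ a (u n [-] l)). pose proof (norm_mul _ (u n [-] l) a).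
  specialize (Hu n). nra.
Qed.

End SquarePowers.

Lemma Csqpow_mul (k : nat) (z w : Cplx) : Csqpow k (Cmul z w) = Cmul (Csqpow k z) (Csqpow k w).
Proof. induction k as [|k IH]; simpl; [reflexivity|]. rewrite IH. cplx. Qed.

Lemma Csqpow_cis (k : nat) (x : R) :
  Csqpow k (mkC (cos (x / 2 ^ k)) (sin (x / 2 ^ k))) = mkC (cos x) (sin x).
Proof.
  revert x. induction k as [|k IH]; intros x; simpl.
  - f_equal; f_equal; field.
  - replace (x / (2 * 2 ^ k)) with ((x / 2) / 2 ^ k) by (field; apply pow_nonzero; lra).
    rewrite IH. replace x with (2 * (x / 2)) at 5 6 by field.
    rewrite cos_2a, sin_2a. cplx.
Qed.

(** Multiplying [a] by such a [z] changes the sign of [sqpow k a], and so turns [1 - sqpow k a] into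
    [1 + sqpow k a]. *)
Lemma root_of_minus_one (k : nat) : exists z, Cmod z = 1 /\ Csqpow k z = Copp C1.
Proof.
  exists (mkC (cos (PI / 2 ^ k)) (sin (PI / 2 ^ k))). split.
  - apply Cmod_unique; [lra|]. simpl. pose proof (sin2_cos2 (PI / 2 ^ k)).
    unfold Rsqr in *. lra.
  - rewrite Csqpow_cis, cos_PI, sin_PI. cplx.
Qed.

(** * Inverses, resolvents and the spectral radius in a unital algebra *)

Section Unital.
Context {B : BanachStarAlgebra} {e : B} (He : is_one e) (Hn : norm e = 1).
Implicit Types a b t v w x : B.

Lemma is_inverse_star t v : is_inverse e t v -> is_inverse e (star t) (star v).
Proof.
  intros [H1 H2]. split; rewrite <- star_mul, ?H1, ?H2; apply star_one; exact He.
Qed.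

Lemma neumann x :
  norm x < 1 -> exists v, is_inverse e (e [-] x) v /\ norm v <= / (1 - norm x).
Proof.
  intros Hx. pose proof (norm_nonneg _ x) as Hx0.
  (* Partial sums of the geometric series in Horner form. The limit satisfies [v = e + x v], which
     is one of the two inverse equations; the other follows because [v] commutes with [x]. *)
  pose (u := fix u n := match n with O => e | S n => e [+] x [*] u n end).
  destruct (geometric_limit u (norm x) (norm x)) as [v Hv]; [lra|lra| |].
  { induction n as [|n IH]; simpl.
    - replace (e [+] x [*] e [-] e) with x by (algu He). lra.
    - simpl in IH. replace (e [+] x [*] (e [+] x [*] u n) [-] (e [+] x [*] u n))
        with (x [*] (e [+] x [*] u n [-] u n)) by alg.
      eapply Rle_trans; [apply norm_mul|]. apply Rmult_le_compat_l; lra. }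
  assert (HK : 0 <= norm x / (1 - norm x)) by (apply Rle_mult_inv_pos; lra).
  set (K := norm x / (1 - norm x)) in *.
  assert (Hvx : commute v x).
  { apply (commute_limit u _ _ K (norm x)); try assumption; try lra.
    intros n. unfold commute. induction n as [|n IH]; simpl.
    - destruct He as [H1 H2]. rewrite H1, H2. reflexivity.
    - rewrite mul_add_l, mul_add_r, <- mul_assoc, IH. f_equal. algu He. }
  assert (Hfix : v = e [+] x [*] v).
  { apply norm_le0_eq. apply (le_pow_le0 _ (2 * K) (norm x)); [lra|lra|]. intros n.
    eapply Rle_trans; [apply (norm_sub_triangle (u (S n)))|].
    rewrite norm_sub_sym.
    replace (u (S n) [-] (e [+] x [*] v)) with (x [*] (u n [-] v)) by (simpl; alg).
    pose proof (norm_mul _ x (u n [-] v)). pose proof (Hv n) as H1. pose proof (Hv (S n)) as H2.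
    simpl in H2. assert (0 <= norm x ^ n) by (apply pow_le; lra).
    pose proof (norm_nonneg _ (u n [-] v)). assert (0 <= K * norm x ^ n) by nra.
    simpl. nra. }
  exists v. split; [split|].
  - transitivity (v [-] x [*] v); [algu He|]. rewrite Hfix at 1. alg.
  - transitivity (v [-] v [*] x); [algu He|]. rewrite Hvx. rewrite Hfix at 1. alg.
  - assert (norm v <= 1 + norm x * norm v).
    { rewrite Hfix at 1. eapply Rle_trans; [apply norm_triangle|].
      pose proof (norm_mul _ x v). lra. }
    apply (Rmult_le_reg_l (1 - norm x)); [lra|]. rewrite Rinv_r by lra. lra.
Qed.

(** The element [v t' = e - v (t - t')] is within 1/2 of [e], so it has an inverse [w] of norm at
    most 2, and [w v] inverts [t']. *)
Lemma inverse_perturb t v t' :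
  is_inverse e t v -> norm (t' [-] t) * norm v <= 1 / 2 ->
  exists v', is_inverse e t' v' /\ norm (v' [-] v) <= 2 * norm v * norm v * norm (t' [-] t).
Proof.
  intros [H1 H2] H.
  assert (Hs : norm (v [*] (t [-] t')) <= 1 / 2).
  { eapply Rle_trans; [apply norm_mul|]. rewrite norm_sub_sym. lra. }
  destruct (neumann (v [*] (t [-] t'))) as [w [[Hw1 Hw2] Hw]]; [lra|].
  assert (E : e [-] v [*] (t [-] t') = v [*] t').
  { rewrite <- H2. alg. }
  rewrite E in Hw1, Hw2.
  exists (w [*] v). split; [split|].
  (* For the right inverse, [t v = e] is inserted in front of [t' w v]. *)
  - transitivity (t [*] (v [*] t' [*] w) [*] v).
    + transitivity (t [*] v [*] (t' [*] w [*] v)); [rewrite H1; algu He | alg].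
    + rewrite Hw1. transitivity (t [*] v); [algu He | exact H1].
  - rewrite <- mul_assoc. exact Hw2.
  - replace (w [*] v [-] v) with (w [*] (v [*] (t [-] t')) [*] v).
    2:{ transitivity (w [*] ((v [*] t) [-] (v [*] t')) [*] v); [alg|].
        rewrite H2, <- E. transitivity (w [*] v [-] w [*] (e [-] v [*] (t [-] t')) [*] v); [algu He|].
        rewrite E, Hw2. algu He. }
    assert (norm w <= 2).
    { eapply Rle_trans; [exact Hw|]. rewrite <- (Rinv_inv 2). apply Rinv_le_contravar; lra. }
    eapply Rle_trans; [apply norm_mul|].
    pose proof (norm_mul _ w (v [*] (t [-] t'))). pose proof (norm_mul _ v (t [-] t')) as H4.
    rewrite (norm_sub_sym t t') in H4.
    pose proof (norm_nonneg _ v). pose proof (norm_nonneg _ w).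
    pose proof (norm_nonneg _ (t' [-] t)). pose proof (norm_nonneg _ (v [*] (t [-] t'))).
    assert (norm w * norm (v [*] (t [-] t')) <= 2 * (norm v * norm (t' [-] t)))
      by (apply Rmult_le_compat; assumption).
    replace (2 * norm v * norm v * norm (t' [-] t))
      with ((2 * (norm v * norm (t' [-] t))) * norm v) by ring.
    apply Rmult_le_compat_r; lra.
Qed.

Lemma resolvent_bounded a :
  (forall z, Cmod z <= 1 -> exists v, is_inverse e (e [-] z [.] a) v) ->
  exists K, forall z, Cmod z <= 1 ->
    exists v, is_inverse e (e [-] z [.] a) v /\ norm v <= K.
Proof.
  intros H.
  assert (Hf : forall z, exists v, Cmod z <= 1 -> is_inverse e (e [-] z [.] a) v).
  { intros z. destruct (Rle_dec (Cmod z) 1) as [Hz|Hz].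
    - destruct (H z Hz) as [v Hv]. exists v. auto.
    - exists e. intros; contradiction. }
  apply functional_choice in Hf. destruct Hf as [f Hf].
  pose proof (norm_nonneg _ a) as Ha.
  (* A gauge on the square around the disc. At a point of the disc it is small enough for the
     inverse there to be perturbed; at a point outside it is too small for the point to cover any
     point of the disc. *)
  assert (Hdelta : forall p : R * R, exists d : posreal, let w := mkC (fst p) (snd p) in
    (Cmod w <= 1 -> 4 * (norm a + 1) * (norm (f w) + 1) * d <= 1) /\
    (1 < Cmod w -> 2 * d <= Cmod w - 1)).
  { intros p. cbv zeta. set (w := mkC (fst p) (snd p)).
    destruct (Rle_lt_dec (Cmod w) 1) as [Hw|Hw].
    - pose proof (norm_nonneg _ (f w)).
      assert (0 < 4 * (norm a + 1) * (norm (f w) + 1)) by nra.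
      exists (mkposreal (/ (4 * (norm a + 1) * (norm (f w) + 1))) (Rinv_0_lt_compat _ H1)).
      split; [|lra]. intros _. cbn [pos]. rewrite Rinv_r; lra.
    - assert (0 < (Cmod w - 1) / 2) by lra.
      exists (mkposreal _ H0). split; [lra|]. intros _. cbn [pos]. lra. }
  apply functional_choice in Hdelta. destruct Hdelta as [delta Hdelta].
  destruct (Compactness.compactness_value_2d (-1) 1 (-1) 1 (fun (x y : R) => delta (x, y))) as [d Hd].
  pose proof (cond_pos d) as Hd0.
  (* Some gauge point [w] near [z] has radius at least [d]. The inverse at [z] has norm at most
     [2 * norm (f w)], and the choice of the radius bounds this by [/ d]. *)
  exists (/ d). intros z Hz. apply NNPP. intros Hno.
  pose proof (Re_le_Cmod z) as Hzr. pose proof (Im_le_Cmod z) as Hzi.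
  apply (Hd (Re z) (Im z)); [split; apply Rnot_lt_le; intros ?; revert Hzr; unfold Rabs; destruct (Rcase_abs _); lra | split; apply Rnot_lt_le; intros ?; revert Hzi; unfold Rabs; destruct (Rcase_abs _); lra|].
  intros [x [y [_ [_ [Hx [Hy Hdxy]]]]]]. apply Hno. clear Hno.
  destruct (Hdelta (x, y)) as [H1 H2]. cbn [fst snd] in H1, H2.
  set (w := mkC x y) in *. set (r := pos (delta (x, y))) in *.
  assert (Hzw : Cmod (Cadd z (Copp w)) < 2 * r).
  { eapply Rle_lt_trans; [apply Cmod_le_Re_Im|]. cbn [Re Im Cadd Copp w].
    unfold Rminus in *. lra. }
  assert (Hw : Cmod w <= 1).
  { apply Rnot_lt_le. intros Hw. specialize (H2 Hw).
    pose proof (Cmod_add z (Copp (Cadd z (Copp w)))) as H3.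
    replace (Cadd z (Copp (Cadd z (Copp w)))) with w in H3 by cplx.
    replace (Cmod (Copp (Cadd z (Copp w)))) with (Cmod (Cadd z (Copp w))) in H3.
    2:{ symmetry. apply Cmod_unique; [apply Cmod_nonneg|]. rewrite Cmod_sqr. simpl. ring. }
    lra. }
  specialize (H1 Hw). specialize (Hf w Hw).
  pose proof (norm_nonneg _ (f w)) as Hfw.
  assert (E : norm ((e [-] z [.] a) [-] (e [-] w [.] a)) <= 2 * r * norm a).
  { replace ((e [-] z [.] a) [-] (e [-] w [.] a)) with (opp (Cadd z (Copp w) [.] a)) by alg.
    rewrite norm_opp, norm_scal. apply Rmult_le_compat_r; lra. }
  assert (Hr : 0 < r) by apply cond_pos.
  assert (Hprod : 4 * r * norm a * norm (f w) <= 1).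
  { assert (norm a * norm (f w) <= (norm a + 1) * (norm (f w) + 1)) by nra. nra. }
  assert (Hsmall : norm ((e [-] z [.] a) [-] (e [-] w [.] a)) * norm (f w) <= 1 / 2) by nra.
  destruct (inverse_perturb _ _ _ Hf Hsmall) as [v [Hv1 Hv2]].
  exists v. split; [exact Hv1|].
  assert (norm v <= 2 * norm (f w)).
  { pose proof (norm_le_sub v (f w)). nra. }
  apply (Rmult_le_reg_l d); [exact Hd0|]. rewrite Rinv_r by lra.
  assert (4 * norm (f w) * r <= 1) by nra. nra.
Qed.

(** The resolvent identity [v - v' = (z - w) v a v']. *)
Lemma resolvent_lipschitz a (K : R) (z w : Cplx) v v' :
  is_inverse e (e [-] z [.] a) v -> is_inverse e (e [-] w [.] a) v' ->
  norm v <= K -> norm v' <= K ->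
  norm (v [-] v') <= K * K * norm a * Cmod (Cadd z (Copp w)).
Proof.
  intros [_ H1] [H2 _] HK HK'.
  replace (v [-] v') with (Cadd z (Copp w) [.] (v [*] a [*] v')).
  - rewrite norm_scal. pose proof (norm_mul _ (v [*] a) v'). pose proof (norm_mul _ v a).
    pose proof (norm_nonneg _ v). pose proof (norm_nonneg _ v'). pose proof (norm_nonneg _ a).
    pose proof (Cmod_nonneg (Cadd z (Copp w))).
    assert (norm (v [*] a) * norm v' <= (K * norm a) * K).
    { apply Rmult_le_compat; try apply norm_nonneg; try lra. nra. }
    rewrite Rmult_comm. apply Rmult_le_compat_r; lra.
  - transitivity (v [*] (e [-] w [.] a) [*] v' [-] v [*] (e [-] z [.] a) [*] v'); [algu He|].
    rewrite H1, <- mul_assoc, H2. algu He.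
Qed.

(** Partial fractions: [2 / (1 - b^2) = 1 / (1 - b) + 1 / (1 + b)]. *)
Lemma inverse_square b v w :
  is_inverse e (e [-] b) v -> is_inverse e (e [+] b) w ->
  is_inverse e (e [-] b [*] b) (RtoC (/2) [.] (v [+] w)).
Proof.
  intros [H1 H2] [H3 H4].
  assert (Hv : v [+] w = RtoC 2 [.] (v [*] w)).
  { transitivity (v [*] ((e [+] b) [*] w) [+] (v [*] (e [-] b)) [*] w);
      [rewrite H2, H3; algu He|algu He]. }
  assert (Hw : v [+] w = RtoC 2 [.] (w [*] v)).
  { transitivity ((w [*] (e [+] b)) [*] v [+] w [*] ((e [-] b) [*] v));
      [rewrite H1, H4; algu He|algu He]. }
  split.
  - rewrite Hw. transitivity ((e [-] b) [*] ((e [+] b) [*] w) [*] v); [algu He|].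
    rewrite H3. transitivity ((e [-] b) [*] v); [algu He|exact H1].
  - rewrite Hw. transitivity (w [*] (v [*] (e [-] b)) [*] (e [+] b)); [algu He|].
    rewrite H2. transitivity (w [*] (e [+] b)); [algu He|exact H4].
Qed.

(** The constant [L] survives squaring because the new inverse is the mean of two old ones. The
    second belongs to [1 + b], that is to [z] times a root of -1, so the induction has to run over
    all [z] on the unit circle. *)
Lemma square_resolvent_lipschitz a (L : R) :
  (forall z w : Cplx, Cmod z <= 1 -> Cmod w <= 1 -> exists v v',
     is_inverse e (e [-] z [.] a) v /\ is_inverse e (e [-] w [.] a) v' /\
     norm (v [-] v') <= L * Cmod (Cadd z (Copp w))) ->
  forall (k : nat) (z : Cplx) (s t : R), Cmod z = 1 -> 0 <= s <= 1 -> 0 <= t <= 1 ->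
  exists v v',
    is_inverse e (e [-] sqpow k (Cmul (RtoC s) z [.] a)) v /\
    is_inverse e (e [-] sqpow k (Cmul (RtoC t) z [.] a)) v' /\
    norm (v [-] v') <= L * Rabs (s - t).
Proof.
  intros H k. induction k as [|k IH]; intros z s t Hz Hs Ht.
  - destruct (H (Cmul (RtoC s) z) (Cmul (RtoC t) z)) as [v [v' [H1 [H2 H3]]]].
    + rewrite Cmod_mul, Cmod_RtoC, Hz, Rabs_right; lra.
    + rewrite Cmod_mul, Cmod_RtoC, Hz, Rabs_right; lra.
    + exists v, v'. split; [exact H1|split; [exact H2|]].
      replace (Cadd (Cmul (RtoC s) z) (Copp (Cmul (RtoC t) z))) with (Cmul (RtoC (s - t)) z)
        in H3 by cplx.
      rewrite Cmod_mul, Cmod_RtoC, Hz, Rmult_1_r in H3. exact H3.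
  - destruct (root_of_minus_one k) as [eta [Heta1 Heta2]].
    destruct (IH z s t Hz Hs Ht) as [v [v' [H1 [H2 H3]]]].
    destruct (IH (Cmul z eta) s t) as [w [w' [H4 [H5 H6]]]]; auto.
    { rewrite Cmod_mul, Hz, Heta1. ring. }
    assert (Hminus : forall r : R, e [-] sqpow k (Cmul (RtoC r) (Cmul z eta) [.] a)
      = e [+] sqpow k (Cmul (RtoC r) z [.] a)).
    { intros r. rewrite !sqpow_scal, !Csqpow_mul, Heta2. alg. }
    rewrite Hminus in H4, H5.
    exists (RtoC (/2) [.] (v [+] w)), (RtoC (/2) [.] (v' [+] w')).
    split; [apply inverse_square; assumption|].
    split; [apply inverse_square; assumption|].
    replace (RtoC (/2) [.] (v [+] w) [-] RtoC (/2) [.] (v' [+] w'))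
      with (RtoC (/2) [.] ((v [-] v') [+] (w [-] w'))) by alg.
    rewrite norm_scal_R, Rabs_right by lra.
    pose proof (norm_triangle _ (v [-] v') (w [-] w')). lra.
Qed.

(** From [b = (v - e) - b (v - e)], a distance [d] of [v] from [e] gives [norm b <= d / (1 - d)],
    and [d < 1/2] makes this less than one. *)
Lemma inverse_near_one b v :
  is_inverse e (e [-] b) v -> norm (v [-] e) < 1 / 2 -> norm b < 1.
Proof.
  intros [H _] Hv.
  assert (E : b = (v [-] e) [-] b [*] (v [-] e)).
  { transitivity (v [-] (e [-] b) [*] v [-] b [*] (v [-] e)); [algu He|].
    rewrite H. alg. }
  pose proof (norm_mul _ b (v [-] e)).
  assert (norm b <= norm (v [-] e) + norm (b [*] (v [-] e))).
  { rewrite E at 1. apply norm_sub_le. }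
  pose proof (norm_nonneg _ b). nra.
Qed.

Lemma inverse_of_near_one b v :
  is_inverse e (e [-] b) v -> norm b <= 1 / 10 -> norm (v [-] e) <= 1 / 9.
Proof.
  intros [H _] Hb.
  assert (E : v [-] e = b [*] v).
  { rewrite <- H at 1. algu He. }
  rewrite E. pose proof (norm_mul _ b v). pose proof (norm_le_sub v e) as H1.
  rewrite E, Hn in H1. pose proof (norm_nonneg _ b). pose proof (norm_nonneg _ v). nra.
Qed.

(* If [1 - z a] is invertible on the closed unit disc, then the spectral radius of [a] is
   less than one.  The inverses of [1 - (t a)^(2^k)] are means of values of the resolvent, so they
   are Lipschitz in [t] uniformly in [k]; this lets smallness of [(t a)^(2^k)] propagate
   from [t = 0] to [t = 1]. *)
Lemma sqpow_lt1_of_invertible a :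
  (forall z, Cmod z <= 1 -> exists v, is_inverse e (e [-] z [.] a) v) ->
  exists k, norm (sqpow k a) < 1.
Proof.
  intros H. destruct (resolvent_bounded a H) as [K HK].
  set (L := K * K * norm a).
  assert (HL0 : 0 <= L).
  { apply Rmult_le_pos; [apply Rle_0_sqr | apply norm_nonneg]. }
  assert (HL : forall k (s t : R), 0 <= s <= 1 -> 0 <= t <= 1 -> exists v v',
    is_inverse e (e [-] sqpow k (RtoC s [.] a)) v /\
    is_inverse e (e [-] sqpow k (RtoC t [.] a)) v' /\
    norm (v [-] v') <= L * Rabs (s - t)).
  { intros k s t Hs Ht.
    destruct (square_resolvent_lipschitz a L) with (k := k) (z := C1) (s := s) (t := t)
      as [v [v' Hv]]; auto.
    - intros z w Hz Hw. destruct (HK z Hz) as [v [H1 H2]]. destruct (HK w Hw) as [v' [H3 H4]].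
      exists v, v'. split; [exact H1|split; [exact H3|]].
      apply resolvent_lipschitz; assumption.
    - apply Cmod_unique; simpl; lra.
    - exists v, v'. rewrite !(fun r => ltac:(cplx) : Cmul (RtoC r) C1 = RtoC r) in Hv. exact Hv. }
  (* A high power at [s] has norm at most 1/10, so its inverse is within 1/9 of [e]. Moving to [t]
     costs at most 1/4, and 1/9 + 1/4 is below the threshold 1/2 of [inverse_near_one]. *)
  assert (Hstep : forall s t : R, 0 <= s <= 1 -> 0 <= t <= 1 -> L * Rabs (s - t) <= 1 / 4 ->
    (exists k, norm (sqpow k (RtoC s [.] a)) < 1) ->
    exists k, norm (sqpow k (RtoC t [.] a)) < 1).
  { intros s t Hs Ht Hst [k Hk]. set (b := sqpow k (RtoC s [.] a)) in *.
    pose proof (norm_nonneg _ b).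
    destruct (pow_eventually_small 1 (norm b) (1 / 10)) as [N HN]; [lra|lra|lra|].
    exists (N + k)%nat. destruct (HL (N + k)%nat s t Hs Ht) as [v [v' [H1 [H2 H3]]]].
    apply (inverse_near_one _ v' H2).
    assert (norm (v [-] e) <= 1 / 9).
    { apply (inverse_of_near_one _ v H1). rewrite sqpow_add. fold b.
      eapply Rle_trans; [apply norm_sqpow_le; lra|].
      specialize (HN (S N) ltac:(lia)). lra. }
    pose proof (norm_sub_triangle v v' e). rewrite (norm_sub_sym v' v) in *. lra. }
  (* Steps of length [1 / N] with [N > 4 L] meet the condition of [Hstep]. *)
  destruct (INR_unbounded (4 * L)) as [N HN].
  assert (HN0 : 0 < INR N) by lra.
  assert (Hwalk : forall j, (j <= N)%nat ->
    exists k, norm (sqpow k (RtoC (INR j / INR N) [.] a)) < 1).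
  { induction j as [|j IH]; intros Hj.
    - exists O. simpl. replace (RtoC (0 / INR N)) with C0 by (apply Cplx_ext; simpl; [field; lra|lra]).
      rewrite scal_C0, norm_zero. lra.
    - apply le_INR in Hj as Hj'. rewrite S_INR in *. pose proof (pos_INR j).
      apply (Hstep (INR j / INR N)); [| | |apply IH; lia].
      + split; [apply Rle_mult_inv_pos; lra|].
        apply (Rmult_le_reg_r (INR N)); [lra|]. field_simplify; lra.
      + split; [apply Rle_mult_inv_pos; lra|].
        apply (Rmult_le_reg_r (INR N)); [lra|]. field_simplify; lra.
      + replace (INR j / INR N - (INR j + 1) / INR N) with (- / INR N) by (field; lra).
        rewrite Rabs_Ropp, Rabs_right by (apply Rle_ge, Rlt_le, Rinv_0_lt_compat; lra).
        apply (Rmult_le_reg_r (INR N)); [lra|]. field_simplify; lra. }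
  destruct (Hwalk N (le_n N)) as [k Hk]. exists k.
  replace (RtoC (INR N / INR N)) with C1 in Hk
    by (apply Cplx_ext; simpl; [field; lra|reflexivity]).
  rewrite scal_one in Hk. exact Hk.
Qed.

(** [1 - z (star a)] is the adjoint of [1 - (Cconj z) a], which is invertible by the Neumann series;
    adjoints of invertible elements are invertible. *)
Lemma sqpow_star_lt1 a : norm a < 1 -> exists k, norm (sqpow k (star a)) < 1.
Proof.
  intros Ha. apply sqpow_lt1_of_invertible. intros z Hz.
  destruct (neumann (Cconj z [.] a)) as [v [Hv _]].
  - rewrite norm_scal, Cmod_conj. pose proof (norm_nonneg _ a). nra.
  - exists (star v). apply is_inverse_star in Hv.
    rewrite star_sub, (star_one e He), star_scal in Hv.
    replace (Cconj (Cconj z)) with z in Hv by cplx. exact Hv.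
Qed.

End Unital.

(** * Hermitian square roots *)

(* [pow_sum w k x] is the sum of the norms of [x w^i] over [i < 2^k]. *)
Fixpoint pow_sum {B : BanachStarAlgebra} (w : B) (k : nat) (x : B) : R :=
  match k with
  | O => norm x
  | S k => pow_sum w k x + pow_sum w k (x [*] sqpow k w)
  end.

Section PowSum.
Context {B : BanachStarAlgebra} (w : B).
Implicit Types x y : B.

Lemma pow_sum_nonneg k x : 0 <= pow_sum w k x.
Proof.
  revert x. induction k as [|k IH]; intros x; simpl; [apply norm_nonneg|].
  pose proof (IH x). pose proof (IH (x [*] sqpow k w)). lra.
Qed.

Lemma norm_le_pow_sum k x : norm x <= pow_sum w k x.
Proof.
  induction k as [|k IH]; simpl; [lra|].
  pose proof (pow_sum_nonneg k (x [*] sqpow k w)). lra.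
Qed.

Lemma pow_sum_add k x y : pow_sum w k (x [+] y) <= pow_sum w k x + pow_sum w k y.
Proof.
  revert x y. induction k as [|k IH]; intros x y; simpl; [apply norm_triangle|].
  rewrite mul_add_l. pose proof (IH x y).
  pose proof (IH (x [*] sqpow k w) (y [*] sqpow k w)). lra.
Qed.

Lemma pow_sum_scal k (z : Cplx) x : pow_sum w k (z [.] x) = Cmod z * pow_sum w k x.
Proof.
  revert x. induction k as [|k IH]; intros x; simpl; [apply norm_scal|].
  rewrite mul_scal_l, !IH. ring.
Qed.

Lemma pow_sum_mul_commute k x y : commute y w -> pow_sum w k (x [*] y) <= norm y * pow_sum w k x.
Proof.
  intros Hyw. revert x. induction k as [|k IH]; intros x; simpl.
  - rewrite Rmult_comm. apply norm_mul.
  - rewrite <- mul_assoc, (commute_sqpow k y w Hyw), mul_assoc.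
    pose proof (IH x). pose proof (IH (x [*] sqpow k w)). lra.
Qed.

(** Both sides are the sum of the norms of [x w^i] over [0 <= i <= 2^k]. *)
Lemma pow_sum_shift k x :
  pow_sum w k (x [*] w) + norm x = pow_sum w k x + norm (x [*] sqpow k w).
Proof.
  revert x. induction k as [|k IH]; intros x; simpl; [lra|].
  rewrite <- mul_assoc, (commute_sqpow k w w eq_refl), !mul_assoc.
  pose proof (IH x). pose proof (IH (x [*] sqpow k w)). lra.
Qed.

(** So [pow_sum w k] is a norm in which right multiplication by [w] is a contraction, even if
    [norm w] exceeds one. *)
Lemma pow_sum_mul_self k x :
  norm (sqpow k w) <= 1 -> pow_sum w k (x [*] w) <= pow_sum w k x.
Proof.
  intros H. pose proof (pow_sum_shift k x). pose proof (norm_mul _ x (sqpow k w)).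
  pose proof (norm_nonneg _ x). nra.
Qed.

End PowSum.

(* Ford's square root lemma, with [1 - y] as the root of [1 - h].  The involution
   may be discontinuous, so [y] being a limit of polynomials in [h] does not give [star y = y];
   but [star y] also solves the equation and its spectral radius is less than one, which
   forces [d = y - star y], a solution of [2 d = d (y + star y)], to vanish. *)
Lemma ford {B : BanachStarAlgebra} (e h : B) :
  is_one e -> norm e = 1 -> star h = h -> norm h < 1 ->
  exists y, star y = y /\ y [+] y = h [+] y [*] y.
Proof.
  intros He Hn Hh Hh1. pose proof (norm_nonneg _ h) as Hh0.
  set (rho := norm h) in *.
  (* Fixed-point iteration for [y = (h + y^2) / 2]. It stays in the ball of radius [rho], on which
     the map contracts by the factor [rho]. *)
  pose (u := fix u n := match n with
    | O => zero | S n => RtoC (/2) [.] (h [+] u n [*] u n) end).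
  assert (Hhalf : forall a : B, norm (RtoC (/2) [.] a) = norm a / 2).
  { intros a. rewrite norm_scal_R, Rabs_right; lra. }
  assert (Hu : forall n, norm (u n) <= rho).
  { induction n as [|n IH]; simpl; [rewrite norm_zero; lra|].
    rewrite Hhalf. pose proof (norm_triangle _ h (u n [*] u n)) as Ht. fold rho in Ht.
    pose proof (norm_mul _ (u n) (u n)). pose proof (norm_nonneg _ (u n)).
    assert (norm (u n) * norm (u n) <= rho * 1) by (apply Rmult_le_compat; lra).
    lra. }
  destruct (geometric_limit u rho rho) as [y Hy]; [lra|lra| |].
  { induction n as [|n IH].
    - simpl. replace (RtoC (/2) [.] (h [+] zero [*] zero) [-] zero) with (RtoC (/2) [.] h) by alg.
      rewrite Hhalf. fold rho. lra.
    - replace (u (S (S n)) [-] u (S n)) with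
        (RtoC (/2) [.] (u (S n) [*] (u (S n) [-] u n) [+] (u (S n) [-] u n) [*] u n)).
      2:{ change (u (S (S n))) with (RtoC (/2) [.] (h [+] u (S n) [*] u (S n))).
          transitivity (RtoC (/2) [.] (h [+] u (S n) [*] u (S n))
             [-] RtoC (/2) [.] (h [+] u n [*] u n)); [alg | reflexivity]. }
      rewrite Hhalf. pose proof (Hu n). pose proof (Hu (S n)).
      set (d := u (S n) [-] u n) in *. pose proof (norm_nonneg _ d).
      pose proof (norm_triangle _ (u (S n) [*] d) (d [*] u n)).
      pose proof (norm_mul _ (u (S n)) d). pose proof (norm_mul _ d (u n)).
      assert (norm (u (S n)) * norm d <= rho * norm d) by (apply Rmult_le_compat_r; lra).
      assert (norm d * norm (u n) <= norm d * rho) by (apply Rmult_le_compat_l; lra).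
      assert (rho * norm d <= rho * (rho * rho ^ n)) by (apply Rmult_le_compat_l; lra).
      change (rho ^ S n) with (rho * rho ^ n). lra. }
  assert (HK : 0 <= rho / (1 - rho)) by (apply Rle_mult_inv_pos; lra).
  set (K := rho / (1 - rho)) in *.
  assert (Hyrho : norm y <= rho).
  { assert (norm y - rho <= 0); [|lra]. apply (le_pow_le0 _ K rho); [lra|lra|]. intros n.
    pose proof (norm_le_sub y (u n)). rewrite norm_sub_sym in H.
    specialize (Hy n). specialize (Hu n). lra. }
  assert (Hfix : y [+] y = h [+] y [*] y).
  { apply norm_le0_eq. apply (le_pow_le0 _ (4 * K) rho); [lra|lra|]. intros n.
    replace (y [+] y [-] (h [+] y [*] y)) with
      ((RtoC 2 [.] (y [-] u (S n))) [+] (u n [*] (u n [-] y) [+] (u n [-] y) [*] y))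
      by (simpl; alg).
    eapply Rle_trans; [apply norm_triangle|]. rewrite norm_scal_R, Rabs_right by lra.
    rewrite (norm_sub_sym y).
    pose proof (Hy n). pose proof (Hy (S n)) as H1. simpl in H1.
    set (d := u n [-] y) in *. pose proof (norm_nonneg _ d).
    pose proof (norm_triangle _ (u n [*] d) (d [*] y)).
    pose proof (norm_mul _ (u n) d). pose proof (norm_mul _ d y). pose proof (Hu n).
    assert (norm (u n) * norm d <= 1 * norm d) by (apply Rmult_le_compat_r; lra).
    assert (norm d * norm y <= norm d * 1) by (apply Rmult_le_compat_l; lra).
    assert (0 <= rho ^ n) by (apply pow_le; lra).
    assert (0 <= K * rho ^ n) by (apply Rmult_le_pos; lra).
    assert (K * (rho * rho ^ n) <= K * rho ^ n) by nra.
    simpl. lra. }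
  assert (Hcomm : forall a, commute h a -> commute y a).
  { intros a Ha. apply (commute_limit u y a K rho); [lra|lra|exact Hy|].
    unfold commute in *. induction n as [|n IH]; simpl.
    - rewrite mul_zero_l, mul_zero_r. reflexivity.
    - rewrite mul_scal_l, mul_scal_r, mul_add_l, mul_add_r. f_equal.
      f_equal; [exact Ha|]. rewrite <- mul_assoc, IH, mul_assoc, IH, mul_assoc. reflexivity. }
  exists y. split; [|exact Hfix].
  set (s := star y) in *.
  assert (Hs : s [+] s = h [+] s [*] s).
  { unfold s. rewrite <- star_mul, <- star_add, Hfix, star_add, Hh. reflexivity. }
  (* Taking adjoints in [y h = h y] shows that [s] commutes with [h], hence with the limit [y] of
     polynomials in [h]. *)
  assert (Hsy : commute y s).
  { apply Hcomm. unfold commute, s. pose proof (Hcomm h eq_refl) as Hyh. unfold commute in Hyh.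
    apply (f_equal star) in Hyh. rewrite !star_mul, Hh in Hyh. exact Hyh. }
  (* Any number strictly between [rho] and 1 would serve: [y / r] still has norm below one, and
     [s = r w] leaves a spare factor [r < 1]. *)
  set (r := (1 + rho) / 2). assert (Hr : 0 < r < 1 /\ rho < r) by (unfold r; lra).
  destruct (sqpow_star_lt1 He Hn (RtoC (/ r) [.] y)) as [k Hk].
  { rewrite norm_scal_R, Rabs_right by (apply Rle_ge, Rlt_le, Rinv_0_lt_compat; lra).
    apply (Rmult_lt_reg_l r); [lra|]. rewrite <- Rmult_assoc, Rinv_r by lra. lra. }
  rewrite star_scal in Hk. fold s in Hk.
  replace (Cconj (RtoC (/ r))) with (RtoC (/ r)) in Hk by cplx.
  set (w := RtoC (/ r) [.] s) in *.
  set (d := y [-] s).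
  assert (Hd : d = RtoC (/2) [.] (d [*] y) [+] RtoC (r / 2) [.] (d [*] w)).
  { transitivity (RtoC (/2) [.] (y [+] y [-] (s [+] s))); [unfold d; alg|].
    rewrite Hfix, Hs. unfold d, w.
    transitivity (RtoC (/2) [.] (y [*] y [-] s [*] s [+] (y [*] s [-] y [*] s))); [alg|].
    transitivity (RtoC (/2) [.] (y [*] y [-] s [*] s [+] (y [*] s [-] s [*] y)));
      [unfold commute in Hsy; rewrite <- Hsy; reflexivity|].
    transitivity (RtoC (/2) [.] ((y [-] s) [*] y) [+] RtoC (/2) [.] ((y [-] s) [*] s)); [alg|].
    f_equal. rewrite mul_scal_r, scal_assoc. f_equal.
    apply Cplx_ext; simpl; field; lra. }
  assert (Hyw : commute y w).
  { unfold commute, w. rewrite mul_scal_l, mul_scal_r, Hsy. reflexivity. }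
  symmetry. apply norm_le0_eq. fold d.
  pose proof (norm_le_pow_sum w k d) as H1. pose proof (norm_nonneg _ d) as H2.
  (* The two terms of [Hd] contribute at most [r / 2] each: the first because [norm y <= r], the
     second because [w] contracts this norm. As [r < 1], [d] vanishes. *)
  assert (H3 : pow_sum w k d <= r * pow_sum w k d); [|nra].
  rewrite Hd at 1. eapply Rle_trans; [apply pow_sum_add|]. rewrite !pow_sum_scal, !Cmod_RtoC.
  rewrite !Rabs_right by lra.
  pose proof (pow_sum_mul_commute w k d y Hyw).
  pose proof (pow_sum_mul_self w k d ltac:(lra)).
  assert (norm y * pow_sum w k d <= r * pow_sum w k d) by (apply Rmult_le_compat_r; lra).
  assert (r / 2 * pow_sum w k (d [*] w) <= r / 2 * pow_sum w k d)
    by (apply Rmult_le_compat_l; lra).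
  lra.
Qed.

(** * Positive functionals *)

Definition sqnorm {A : BanachStarAlgebra} (phi : A -> Cplx) (a : A) : R :=
  Re (phi (star a [*] a)).

Section Positive.
Context {A : BanachStarAlgebra} {phi : A -> Cplx}.
Context (Hlin : linear_functional A phi) (Hpos : positive_functional A phi).
Implicit Types a b : A.

Lemma phi_add a b : phi (a [+] b) = Cadd (phi a) (phi b).
Proof. apply Hlin. Qed.

Lemma phi_scal (z : Cplx) a : phi (z [.] a) = Cmul z (phi a).
Proof. apply Hlin. Qed.

Lemma phi_sub a b : phi (a [-] b) = Cadd (phi a) (Copp (phi b)).
Proof. unfold sub. rewrite opp_scal, phi_add, phi_scal. cplx. Qed.

Lemma phi_zero : phi zero = C0.
Proof. rewrite <- (scal_C0 zero), phi_scal. cplx. Qed.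

Lemma sqnorm_nonneg a : 0 <= sqnorm phi a.
Proof. apply Hpos. Qed.

Lemma phi_square_expand (z : Cplx) a b :
  phi (star (a [+] z [.] b) [*] (a [+] z [.] b)) =
  Cadd (Cadd (phi (star a [*] a)) (Cmul z (phi (star a [*] b))))
       (Cadd (Cmul (Cconj z) (phi (star b [*] a)))
             (Cmul (Cmul (Cconj z) z) (phi (star b [*] b)))).
Proof.
  rewrite star_add, star_scal, <- !phi_scal, <- !phi_add. f_equal. alg.
Qed.

(** Polarization: the values at the squares of [a + b] and of [a + i b] are real. *)
Lemma phi_hermitian a b : phi (star a [*] b) = Cconj (phi (star b [*] a)).
Proof.
  pose proof (phi_square_expand C1 a b) as H1.
  pose proof (phi_square_expand (mkC 0 1) a b) as H2.
  destruct (Hpos (a [+] C1 [.] b)) as [I1 _]. destruct (Hpos (a [+] mkC 0 1 [.] b)) as [I2 _].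
  destruct (Hpos a) as [I3 _]. destruct (Hpos b) as [I4 _].
  rewrite H1 in I1. rewrite H2 in I2. simpl in I1, I2. rewrite I3, I4 in *.
  apply Cplx_ext; simpl; lra.
Qed.

Lemma cauchy_schwarz a b :
  Cmod (phi (star a [*] b)) * Cmod (phi (star a [*] b)) <= sqnorm phi a * sqnorm phi b.
Proof.
  rewrite Cmod_sqr.
  assert (H : forall x y : R, 0 <= sqnorm phi a
     + 2 * (x * Re (phi (star a [*] b)) - y * Im (phi (star a [*] b)))
     + (x * x + y * y) * sqnorm phi b).
  { intros x y. destruct (Hpos (a [+] mkC x y [.] b)) as [_ H].
    rewrite phi_square_expand, (phi_hermitian b a) in H. simpl in H.
    destruct (Hpos b) as [I _]. rewrite I in H. unfold sqnorm. lra. }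
  set (p := Re (phi (star a [*] b))) in *. set (q := Im (phi (star a [*] b))) in *.
  pose proof (sqnorm_nonneg a) as Ha. pose proof (sqnorm_nonneg b) as Hb.
  set (na := sqnorm phi a) in *. set (nb := sqnorm phi b) in *.
  destruct Hb as [Hb|Hb].
  (* The minimum of the quadratic expression. *)
  - specialize (H (- p / nb) (q / nb)).
    apply (Rmult_le_compat_r nb) in H; [|lra].
    replace ((na + 2 * (- p / nb * p - q / nb * q)
      + (- p / nb * (- p / nb) + q / nb * (q / nb)) * nb) * nb)
      with (na * nb - (p * p + q * q)) in H by (field; lra).
    lra.
  (* For [nb = 0] the expression is affine; at the point chosen below it equals [- na - 2], which is
     negative. *)
  - rewrite <- Hb in *. assert (p * p + q * q <= 0); [|lra].
    apply Rnot_lt_le. intros Hm.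
    specialize (H (- p * ((na + 1) / (p * p + q * q))) (q * ((na + 1) / (p * p + q * q)))).
    rewrite Rmult_0_r, Rplus_0_r in H.
    replace (na + 2 * (- p * ((na + 1) / (p * p + q * q)) * p
      - q * ((na + 1) / (p * p + q * q)) * q)) with (na - 2 * (na + 1)) in H by (field; lra).
    lra.
Qed.

Lemma sqnorm_scal (z : Cplx) a : sqnorm phi (z [.] a) = Cmod z * Cmod z * sqnorm phi a.
Proof.
  unfold sqnorm. rewrite star_scal.
  replace ((Cconj z [.] star a) [*] (z [.] a)) with (Cmul (Cconj z) z [.] (star a [*] a)) by alg.
  rewrite phi_scal, Cmod_sqr. destruct (Hpos a) as [I _]. simpl. rewrite I. ring.
Qed.

(** The parallelogram law with the term of [a - b] dropped. *)
Lemma sqnorm_add_le a b : sqnorm phi (a [+] b) <= 2 * sqnorm phi a + 2 * sqnorm phi b.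
Proof.
  pose proof (sqnorm_nonneg (a [+] Copp C1 [.] b)) as H.
  replace (a [+] b) with (a [+] C1 [.] b) by alg.
  unfold sqnorm in *. rewrite phi_square_expand in *. simpl in *. lra.
Qed.

Lemma phi_mul_null a b : sqnorm phi b = 0 -> phi (star a [*] b) = C0.
Proof.
  intros H. apply Cmod_eq0. pose proof (cauchy_schwarz a b) as Hcs. rewrite H in Hcs.
  pose proof (Cmod_nonneg (phi (star a [*] b))). nra.
Qed.

End Positive.

Lemma le_of_le_scaled (x y r0 : R) :
  0 <= y -> (forall r, r0 < r -> x <= r * y) -> x <= r0 * y.
Proof.
  intros Hy H. apply Rnot_lt_le. intros Hx.
  specialize (H (r0 + (x - r0 * y) / (2 * (y + 1)))).
  assert (0 < (x - r0 * y) / (2 * (y + 1))) by (apply Rdiv_lt_0_compat; lra).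
  specialize (H ltac:(lra)).
  assert ((x - r0 * y) / (2 * (y + 1)) * y <= (x - r0 * y) / 2); [|lra].
  apply (Rmult_le_reg_r (2 * (y + 1))); [lra|].
  replace ((x - r0 * y) / (2 * (y + 1)) * y * (2 * (y + 1))) with ((x - r0 * y) * y) by (field; lra).
  nra.
Qed.

(** * Boundedness of the representation induced by a positive functional on a unital algebra *)

Section UnitalPositive.
Context {B : BanachStarAlgebra} {e : B} (He : is_one e) (Hn : norm e = 1).
Context {psi : B -> Cplx}.
Context (Hlin : linear_functional B psi) (Hpos : positive_functional B psi).
Implicit Types s t v x y : B.

Notation N := (sqnorm psi).

(** Ford's lemma gives a hermitian [y] with [(1 - y)^2 = 1 - (star t) t / r], so
    [N s - N (t s) / r = N ((1 - y) s)] is nonnegative for every [r > norm (star t [*] t)]. *)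
Lemma sqnorm_mul_le t s : N (t [*] s) <= norm (star t [*] t) * N s.
Proof.
  apply le_of_le_scaled; [apply (sqnorm_nonneg Hpos)|]. intros r Hr.
  set (h := star t [*] t) in *. pose proof (norm_nonneg _ h).
  assert (Hri : 0 < / r) by (apply Rinv_0_lt_compat; lra).
  destruct (ford e (RtoC (/ r) [.] h)) as [y [Hy1 Hy2]]; [exact He|exact Hn| | |].
  - unfold h. rewrite star_scal, star_mul, star_star. f_equal. cplx.
  - rewrite norm_scal_R, Rabs_right by lra.
    apply (Rmult_lt_reg_l r); [lra|]. rewrite <- Rmult_assoc, Rinv_r by lra. lra.
  - pose proof (sqnorm_nonneg Hpos ((e [-] y) [*] s)) as H0.
    assert (E : star ((e [-] y) [*] s) [*] ((e [-] y) [*] s)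
      = star s [*] s [-] RtoC (/ r) [.] (star (t [*] s) [*] (t [*] s))).
    { rewrite !star_mul, star_sub, Hy1, (star_one e He).
      transitivity (star s [*] (e [-] (y [+] y) [+] y [*] y) [*] s); [algu He|].
      rewrite Hy2. unfold h. algu He. }
    unfold sqnorm in *. rewrite E, (phi_sub Hlin), (phi_scal Hlin) in H0. simpl in H0.
    apply (Rmult_le_reg_l (/ r)); [lra|]. rewrite <- Rmult_assoc, Rinv_l by lra. lra.
Qed.

(** The kernel of the representation. The lemmas below show that it is a two-sided ideal stable
    under the involution. *)
Definition null (n : B) : Prop := forall s, N (n [*] s) = 0.

Lemma null_zero : null zero.
Proof.
  intros s. unfold sqnorm. rewrite mul_zero_l, mul_zero_r, (phi_zero Hlin). reflexivity.
Qed.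

Lemma null_add n n' : null n -> null n' -> null (n [+] n').
Proof.
  intros H H' s. rewrite mul_add_l.
  pose proof (sqnorm_add_le Hlin Hpos (n [*] s) (n' [*] s)) as H1. rewrite H, H' in H1.
  pose proof (sqnorm_nonneg Hpos (n [*] s [+] n' [*] s)). lra.
Qed.

Lemma null_scal (z : Cplx) n : null n -> null (z [.] n).
Proof. intros H s. rewrite mul_scal_l, (sqnorm_scal Hlin Hpos), H. ring. Qed.

Lemma null_mul_r n t : null n -> null (n [*] t).
Proof. intros H s. rewrite <- mul_assoc. apply H. Qed.

Lemma null_mul_l n t : null n -> null (t [*] n).
Proof.
  intros H s. rewrite <- mul_assoc. pose proof (sqnorm_mul_le t (n [*] s)) as H1.
  rewrite H in H1. pose proof (sqnorm_nonneg Hpos (t [*] (n [*] s))). lra.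
Qed.

(** [N (star n [*] s)] pairs [s] with [n [*] (star n [*] s)], a vector of seminorm zero. *)
Lemma null_star n : null n -> null (star n).
Proof.
  intros H s. unfold sqnorm.
  rewrite star_mul, star_star.
  replace (star s [*] n [*] (star n [*] s)) with (star s [*] (n [*] (star n [*] s))) by alg.
  rewrite (phi_mul_null Hlin Hpos); [reflexivity | apply H].
Qed.

Lemma null_sub n n' : null n -> null n' -> null (n [-] n').
Proof.
  intros H H'. unfold sub. rewrite opp_scal. apply null_add; [exact H|apply null_scal; exact H'].
Qed.

(** Modulo the kernel [u] is [star t [*] t], so [N (t s)] is the pairing of [s] with [u s]; then
    Cauchy-Schwarz. *)
Lemma sqnorm_sqr_le u t s :
  null (u [-] star t [*] t) -> N (t [*] s) * N (t [*] s) <= N s * N (u [*] s).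
Proof.
  intros H.
  assert (E : psi (star (t [*] s) [*] (t [*] s)) = psi (star s [*] (u [*] s))).
  { transitivity (psi (star s [*] (u [*] s) [-] star s [*] ((u [-] star t [*] t) [*] s))).
    - f_equal. rewrite star_mul. alg.
    - rewrite (phi_sub Hlin), (phi_mul_null Hlin Hpos _ _ (H s)). cplx. }
  pose proof (cauchy_schwarz Hlin Hpos s (u [*] s)) as Hcs.
  pose proof (Re_le_Cmod (psi (star s [*] (u [*] s)))) as Hre.
  pose proof (sqnorm_nonneg Hpos (t [*] s)) as H0.
  unfold sqnorm at 1 2. unfold sqnorm in H0. rewrite E in *.
  rewrite Rabs_right in Hre by lra. nra.
Qed.

Lemma sqpow_almost_hermitian u k :
  null (u [-] star u) -> null (sqpow k u [-] star (sqpow k u)).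
Proof.
  intros H. induction k as [|k IH]; simpl; [exact H|].
  rewrite star_mul. set (v := sqpow k u) in *.
  replace (v [*] v [-] star v [*] star v)
    with (v [*] (v [-] star v) [+] (v [-] star v) [*] star v) by alg.
  apply null_add; [apply null_mul_l | apply null_mul_r]; exact IH.
Qed.

(** For [v] hermitian modulo the kernel, [N (v s)^2 <= N s * N (v^2 s)]; the bound descends from
    [v^2] to [v], one square root at a time. *)
Lemma sqnorm_le_of_sqpow u k s :
  null (u [-] star u) -> N (sqpow k u [*] s) <= N s -> N (u [*] s) <= N s.
Proof.
  intros H. induction k as [|k IH]; simpl; [auto|]. intros Hk. apply IH.
  pose proof (sqpow_almost_hermitian u k H) as Hv. set (v := sqpow k u) in *.
  assert (Hs : N (v [*] s) * N (v [*] s) <= N s * N ((v [*] v) [*] s)).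
  { apply sqnorm_sqr_le. replace (v [*] v [-] star v [*] v) with ((v [-] star v) [*] v) by alg.
    apply null_mul_r. exact Hv. }
  pose proof (sqnorm_nonneg Hpos s). pose proof (sqnorm_nonneg Hpos (v [*] s)). nra.
Qed.

(** After scaling, [norm v < 1], so for some [k] both [v^(2^k)] and its adjoint have norm at most
    one. [sqnorm_mul_le] then bounds the action of [v^(2^k)], and the bound descends to [v]. *)
Lemma sqnorm_mul_le_of_almost_hermitian u s :
  null (u [-] star u) -> N (u [*] s) <= norm u * norm u * N s.
Proof.
  intros H. apply le_of_le_scaled; [apply (sqnorm_nonneg Hpos)|]. intros r2 Hr2.
  pose proof (norm_nonneg _ u) as Hu.
  assert (Hr20 : 0 < r2) by nra.
  set (r := sqrt r2). assert (Hr : 0 < r) by (apply sqrt_lt_R0; exact Hr20).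
  assert (Hrr : r * r = r2) by (apply sqrt_sqrt; lra).
  assert (Hur : norm u < r) by nra.
  assert (Hri : 0 < / r) by (apply Rinv_0_lt_compat; lra).
  set (v := RtoC (/ r) [.] u).
  assert (Hv1 : norm v < 1).
  { unfold v. rewrite norm_scal_R, Rabs_right by lra.
    apply (Rmult_lt_reg_l r); [lra|]. rewrite <- Rmult_assoc, Rinv_r by lra. lra. }
  assert (Hv : null (v [-] star v)).
  { unfold v. rewrite star_scal.
    replace (RtoC (/ r) [.] u [-] Cconj (RtoC (/ r)) [.] star u)
      with (RtoC (/ r) [.] (u [-] star u)); [apply null_scal; exact H|].
    replace (Cconj (RtoC (/ r))) with (RtoC (/ r)) by cplx. alg. }
  destruct (sqpow_star_lt1 He Hn v Hv1) as [k Hk].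
  assert (Hvs : N (v [*] s) <= N s).
  { apply (sqnorm_le_of_sqpow v k s Hv). eapply Rle_trans; [apply sqnorm_mul_le|].
    rewrite <- sqpow_star. pose proof (sqnorm_nonneg Hpos s).
    pose proof (norm_mul _ (sqpow k (star v)) (sqpow k v)).
    assert (norm (sqpow k v) <= 1) by (apply (norm_sqpow_le1 k 0); [lia | simpl; lra]).
    pose proof (norm_nonneg _ (sqpow k v)). pose proof (norm_nonneg _ (sqpow k (star v))).
    assert (norm (sqpow k (star v)) * norm (sqpow k v) <= 1 * 1)
      by (apply Rmult_le_compat; lra).
    nra. }
  replace (u [*] s) with (RtoC r [.] (v [*] s)).
  - rewrite (sqnorm_scal Hlin Hpos), Cmod_RtoC, Rabs_right, Hrr by lra.
    apply Rmult_le_compat_l; lra.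
  - unfold v. rewrite mul_scal_l, scal_assoc.
    replace (Cmul (RtoC r) (RtoC (/ r))) with C1
      by (apply Cplx_ext; simpl; field; lra).
    apply scal_one.
Qed.

(* [y] represents the adjoint of [x] in the quotient by the null ideal; unlike [star x], it can
   be chosen of norm comparable to that of [x]. *)
Definition adjoint_mod_null (x y : B) : Prop := null (y [-] star x).

(** [y x] represents [(star x) x] and is therefore hermitian modulo the kernel. So
    [N (x s)^2 <= N s * N (y x s)], and the last factor is at most [norm (y x)^2 * N s]. *)
Lemma sqnorm_mul_le_adjoint x y s :
  adjoint_mod_null x y -> N (x [*] s) <= norm y * norm x * N s.
Proof.
  unfold adjoint_mod_null. intros H. set (m := y [-] star x) in *.
  pose proof (norm_nonneg _ x). pose proof (norm_nonneg _ y).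
  pose proof (sqnorm_nonneg Hpos s). pose proof (sqnorm_nonneg Hpos (x [*] s)).
  assert (Hu : null (y [*] x [-] star (y [*] x))).
  { replace (y [*] x [-] star (y [*] x)) with (m [*] x [-] star (m [*] x)).
    - apply null_sub; [|apply null_star]; apply null_mul_r; exact H.
    - unfold m. rewrite !star_mul, star_sub, star_star. alg. }
  pose proof (sqnorm_mul_le_of_almost_hermitian _ s Hu) as Hyx.
  assert (Hsq : N (x [*] s) * N (x [*] s) <= N s * N ((y [*] x) [*] s)).
  { apply sqnorm_sqr_le.
    replace (y [*] x [-] star x [*] x) with (m [*] x) by (unfold m; alg).
    apply null_mul_r. exact H. }
  set (c := norm (y [*] x)) in *. assert (Hc : c <= norm y * norm x) by apply norm_mul.
  pose proof (norm_nonneg _ (y [*] x)) as Hc0. fold c in Hc0.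
  assert (Hcs : 0 <= c * N s) by (apply Rmult_le_pos; assumption).
  assert (N (x [*] s) * N (x [*] s) <= (c * N s) * (c * N s)) by nra.
  assert (N (x [*] s) <= c * N s) by nra.
  nra.
Qed.

(** The graph is closed: if [x] tends to 0 and [y] to [c], then [c] is null. Split [star c] into
    [star c - x], with adjoint [c - y] of small norm, and [x], itself of small norm;
    [sqnorm_mul_le_adjoint] makes both act by small operators. *)
Lemma null_of_adjoint_limit (c : B) :
  (forall eps, 0 < eps -> exists x y, adjoint_mod_null x y /\
     norm x <= eps /\ norm (c [-] y) <= eps) -> null c.
Proof.
  intros H. rewrite <- star_star. apply null_star. intros s.
  pose proof (norm_nonneg _ c). pose proof (norm_nonneg _ (star c)).
  pose proof (sqnorm_nonneg Hpos s) as Hs.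
  assert (N (star c [*] s) <= 0 * (2 * (norm c + norm (star c) + 2) * N s)).
  2:{ pose proof (sqnorm_nonneg Hpos (star c [*] s)). lra. }
  apply le_of_le_scaled; [nra|]. intros r Hr.
  set (eps := Rmin r 1). assert (He0 : 0 < eps) by (apply Rmin_glb_lt; lra).
  assert (eps <= 1) by apply Rmin_r. assert (eps <= r) by apply Rmin_l.
  destruct (H eps He0) as [x [y [Hxy [Hx Hy]]]].
  pose proof (sqnorm_mul_le_adjoint x y s Hxy) as H5.
  assert (Hxy' : adjoint_mod_null (star c [-] x) (c [-] y)).
  { unfold adjoint_mod_null. rewrite star_sub, star_star.
    replace (c [-] y [-] (c [-] star x)) with (Copp C1 [.] (y [-] star x)) by alg.
    apply null_scal. exact Hxy. }
  pose proof (sqnorm_mul_le_adjoint _ _ s Hxy') as H6.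
  replace (star c [*] s) with ((star c [-] x) [*] s [+] x [*] s) by alg.
  eapply Rle_trans; [apply (sqnorm_add_le Hlin Hpos)|].
  pose proof (norm_sub_le (star c) x). pose proof (norm_le_sub y c).
  rewrite (norm_sub_sym y c) in *.
  pose proof (norm_nonneg _ x). pose proof (norm_nonneg _ y).
  pose proof (norm_nonneg _ (c [-] y)). pose proof (norm_nonneg _ (star c [-] x)).
  assert (norm (c [-] y) * norm (star c [-] x) <= eps * (norm (star c) + 1))
    by (apply Rmult_le_compat; lra).
  assert (norm y * norm x <= (norm c + 1) * eps) by (apply Rmult_le_compat; lra).
  assert (norm (c [-] y) * norm (star c [-] x) * N s + norm y * norm x * N s
    <= eps * (norm c + norm (star c) + 2) * N s) by nra.
  assert (eps * ((norm c + norm (star c) + 2) * N s) <= r * ((norm c + norm (star c) + 2) * N s)).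
  { apply Rmult_le_compat_r; [|lra]. apply Rmult_le_pos; lra. }
  lra.
Qed.

Lemma adjoint_mod_null_sub x y x' y' :
  adjoint_mod_null x y -> adjoint_mod_null x' y' -> adjoint_mod_null (x [-] x') (y [-] y').
Proof.
  unfold adjoint_mod_null. intros H H'. rewrite star_sub.
  replace (y [-] y' [-] (star x [-] star x')) with ((y [-] star x) [-] (y' [-] star x')) by alg.
  apply null_sub; assumption.
Qed.

Lemma adjoint_mod_null_star x : adjoint_mod_null x (star x).
Proof. unfold adjoint_mod_null. rewrite sub_diag. apply null_zero. Qed.

(** Baire's theorem for the sets of [x] having an adjoint of norm at most [n], which cover since
    [star x] is one. Differences carry the density from a ball around [x0] to one around 0. *)
Lemma adjoint_approx : exists C, 0 <= C /\ forall x, exists v y,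
  norm (x [-] v) <= norm x / 2 /\ adjoint_mod_null v y /\ norm y <= C * norm x.
Proof.
  destruct (baire (fun n (x : B) => exists y, adjoint_mod_null x y /\ norm y <= INR n))
    as [n [x0 [r [Hr H]]]].
  { intros x. destruct (INR_unbounded (norm (star x))) as [n Hn'].
    exists n, (star x). split; [apply adjoint_mod_null_star | lra]. }
  pose proof (pos_INR n) as Hn0.
  (* Since [l x] has norm [r / 2], two errors of [r / 8] add up to half of it, and the adjoint of
     norm at most [2 n] is divided by [l = r / (2 * norm x)]. *)
  exists (4 * INR n / r). split; [apply Rle_mult_inv_pos; lra|]. intros x.
  destruct (Req_dec (norm x) 0) as [Hx|Hx].
  { apply norm_eq0 in Hx. subst x. exists zero, zero. rewrite sub_diag, norm_zero.
    split; [lra|split; [|lra]]. pose proof (adjoint_mod_null_star zero) as H0.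
    replace (star (@zero B)) with (@zero B) in H0; [exact H0|].
    rewrite <- (scal_C0 zero), star_scal. replace (Cconj C0) with C0 by cplx.
    rewrite !scal_C0. reflexivity. }
  pose proof (norm_nonneg _ x). assert (Hx0 : 0 < norm x) by lra.
  set (l := r / (2 * norm x)). assert (Hl : 0 < l) by (apply Rdiv_lt_0_compat; lra).
  assert (Hlx : l * norm x = r / 2) by (unfold l; field; lra).
  destruct (H (x0 [+] RtoC l [.] x)) with (eps := r / 8) as [v1 [[y1 [Hv1 Hy1]] Hxv1]]; [|lra|].
  { replace (x0 [+] RtoC l [.] x [-] x0) with (RtoC l [.] x) by alg.
    rewrite norm_scal_R, Rabs_right; lra. }
  destruct (H x0) with (eps := r / 8) as [v2 [[y2 [Hv2 Hy2]] Hxv2]]; [|lra|].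
  { rewrite sub_diag, norm_zero. exact Hr. }
  assert (Hli : 0 < / l) by (apply Rinv_0_lt_compat; exact Hl).
  exists (RtoC (/ l) [.] (v1 [-] v2)), (RtoC (/ l) [.] (y1 [-] y2)). split; [|split].
  - replace (x [-] RtoC (/ l) [.] (v1 [-] v2)) with
      (RtoC (/ l) [.] ((x0 [+] RtoC l [.] x [-] v1) [-] (x0 [-] v2))).
    2:{ transitivity (RtoC (/ l) [.] (RtoC l [.] x) [-] RtoC (/ l) [.] (v1 [-] v2)); [alg|].
        f_equal. rewrite scal_assoc. replace (Cmul (RtoC (/ l)) (RtoC l)) with C1
          by (apply Cplx_ext; simpl; field; lra). apply scal_one. }
    rewrite norm_scal_R, Rabs_right by lra.
    pose proof (norm_sub_le (x0 [+] RtoC l [.] x [-] v1) (x0 [-] v2)).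
    apply (Rmult_le_reg_l l); [exact Hl|]. rewrite <- Rmult_assoc, Rinv_r by lra. lra.
  - unfold adjoint_mod_null. rewrite star_scal.
    replace (Cconj (RtoC (/ l))) with (RtoC (/ l)) by cplx.
    replace (RtoC (/ l) [.] (y1 [-] y2) [-] RtoC (/ l) [.] star (v1 [-] v2))
      with (RtoC (/ l) [.] ((y1 [-] y2) [-] star (v1 [-] v2))) by alg.
    apply null_scal. apply adjoint_mod_null_sub; assumption.
  - rewrite norm_scal_R, Rabs_right by lra. pose proof (norm_sub_le y1 y2).
    apply (Rmult_le_reg_l l); [exact Hl|]. rewrite <- Rmult_assoc, Rinv_r by lra.
    replace (l * (4 * INR n / r * norm x)) with (4 * INR n / r * (l * norm x)) by ring.
    rewrite Hlx. replace (4 * INR n / r * (r / 2)) with (2 * INR n) by (field; lra). lra.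
Qed.

(** Successive approximation: the remainders [r n] halve in norm, and the adjoints of the removed
    parts sum to [y]. Now [star x - u n] is an adjoint of [r n], which tends to 0, so the closed
    graph makes [star x - y] null. *)
Lemma adjoint_exact : exists K, 0 <= K /\ forall x, exists y,
  adjoint_mod_null x y /\ norm y <= K * norm x.
Proof.
  destruct adjoint_approx as [C [HC H]].
  exists (2 * C). split; [lra|]. intros x.
  assert (Hf : forall x : B, exists vy : B * B, norm (x [-] fst vy) <= norm x / 2 /\
    adjoint_mod_null (fst vy) (snd vy) /\ norm (snd vy) <= C * norm x).
  { intros x'. destruct (H x') as [v [y Hvy]]. exists (v, y). exact Hvy. }
  apply functional_choice in Hf. destruct Hf as [f Hf].
  pose (r := fix r n := match n with O => x | S n => r n [-] fst (f (r n)) end).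
  pose (u := fix u n := match n with O => zero | S n => u n [+] snd (f (r n)) end).
  pose proof (norm_nonneg _ x) as Hx.
  assert (Hr : forall n, norm (r n) <= norm x * (/2) ^ n).
  { induction n as [|n IH]; simpl; [lra|]. destruct (Hf (r n)) as [H1 _]. lra. }
  destruct (geometric_limit u (C * norm x) (/2)) as [y Hy]; [lra|nra| |].
  { intros n. simpl. replace (u n [+] snd (f (r n)) [-] u n) with (snd (f (r n))) by alg.
    destruct (Hf (r n)) as [_ [_ H1]]. specialize (Hr n). nra. }
  assert (Hadj : forall n, adjoint_mod_null (r n) (star x [-] u n)).
  { induction n as [|n IH]; simpl.
    - replace (star x [-] zero) with (star x) by alg. apply adjoint_mod_null_star.
    - replace (star x [-] (u n [+] snd (f (r n)))) with (star x [-] u n [-] snd (f (r n))) by alg.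
      apply adjoint_mod_null_sub; [exact IH | apply Hf]. }
  assert (HK0 : 0 <= C * norm x / (1 - /2)) by (apply Rle_mult_inv_pos; nra).
  exists y. split.
  - unfold adjoint_mod_null.
    replace (y [-] star x) with (Copp C1 [.] (star x [-] y)) by alg. apply null_scal.
    apply null_of_adjoint_limit. intros eps Heps.
    destruct (pow_eventually_small (norm x) (/2) eps) as [n1 Hn1]; [lra|lra|lra|].
    destruct (pow_eventually_small (C * norm x / (1 - /2)) (/2) eps) as [n2 Hn2]; [lra|lra|lra|].
    set (n := (n1 + n2)%nat). exists (r n), (star x [-] u n).
    split; [apply Hadj|]. split.
    + specialize (Hr n). specialize (Hn1 n ltac:(lia)). lra.
    + replace (star x [-] y [-] (star x [-] u n)) with (u n [-] y) by alg.
      specialize (Hy n). specialize (Hn2 n ltac:(lia)). lra.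
  - specialize (Hy O). simpl in Hy. rewrite norm_sub_sym in Hy.
    replace (y [-] zero) with y in Hy by alg.
    replace (C * norm x / (1 - /2) * 1) with (2 * C * norm x) in Hy by field. exact Hy.
Qed.

Lemma unital_positive_bounded :
  exists K, 0 <= K /\ forall x s, N (x [*] s) <= K * (norm x * norm x) * N s.
Proof.
  destruct adjoint_exact as [K [HK H]]. exists K. split; [exact HK|]. intros x s.
  destruct (H x) as [y [Hxy Hy]].
  eapply Rle_trans; [apply (sqnorm_mul_le_adjoint x y s Hxy)|].
  apply Rmult_le_compat_r; [apply (sqnorm_nonneg Hpos)|].
  pose proof (norm_nonneg _ x). nra.
Qed.

End UnitalPositive.

(** * Factorization along a bounded left approximate unit *)

Definition vanishing {A : BanachStarAlgebra} (a : nat -> A) : Prop :=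
  forall eps, 0 < eps -> exists N : nat, forall n, (N <= n)%nat -> norm (a n) <= eps.

(** All that Cohen's construction uses of the net: one [u] serves a whole null sequence at once. *)
Definition approximates_left_unit (A : BanachStarAlgebra) (M : R) : Prop :=
  forall (a : nat -> A) (eps : R), vanishing a -> 0 < eps ->
  exists u : A, norm u <= M /\ forall n, norm (u [*] a n [-] a n) <= eps.

Lemma left_approx_unit_uniform (A : BanachStarAlgebra) (I : Type) (le : I -> I -> Prop)
    (u : I -> A) :
  bounded_left_approx_unit A I le u -> exists M, 0 <= M /\ approximates_left_unit A M.
Proof.
  intros [[[i0] [Hrefl [Htrans Hdir]]] [[M HM] Hlim]].
  assert (HM0 : 0 <= M).
  { specialize (HM i0). pose proof (norm_nonneg _ (u i0)). lra. }
  exists M. split; [exact HM0|]. intros a eps Ha Heps.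
  assert (Hfin : forall N, exists i, forall n, (n < N)%nat -> forall j, le i j ->
    norm (u j [*] a n [-] a n) <= eps).
  { induction N as [|N [i Hi]].
    - exists i0. intros n Hn. lia.
    - destruct (Hlim (a N) eps Heps) as [i' Hi']. destruct (Hdir i i') as [k [Hk Hk']].
      exists k. intros n Hn j Hj. destruct (PeanoNat.Nat.eq_dec n N) as [->|HnN].
      + apply Rlt_le. apply Hi'. apply (Htrans _ k); assumption.
      + apply Hi; [lia|]. apply (Htrans _ k); assumption. }
  (* Directedness handles finitely many terms; for the tail [norm (u a - a) <= (M + 1) * norm a]
     suffices. *)
  destruct (Ha (eps / (M + 1))) as [N HN]; [apply Rdiv_lt_0_compat; lra|].
  destruct (Hfin N) as [i Hi]. exists (u i). split; [apply HM|].
  intros n. destruct (Compare_dec.le_lt_dec N n) as [Hn|Hn]; [|apply Hi; [exact Hn|apply Hrefl]].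
  specialize (HN n Hn).
  assert (H : (M + 1) * norm (a n) <= eps).
  { apply (Rmult_le_compat_l (M + 1)) in HN; [|lra].
    replace ((M + 1) * (eps / (M + 1))) with eps in HN by (field; lra). exact HN. }
  eapply Rle_trans; [apply norm_sub_le|]. pose proof (norm_mul _ (u i) (a n)).
  specialize (HM i). pose proof (norm_nonneg _ (a n)). nra.
Qed.

Lemma vanishing_bounded {A : BanachStarAlgebra} (a : nat -> A) :
  vanishing a -> exists S, 0 <= S /\ forall n, norm (a n) <= S.
Proof.
  intros Ha. destruct (Ha 1) as [N HN]; [lra|].
  assert (H : forall k, exists S, 0 <= S /\ forall n, (n < k)%nat -> norm (a n) <= S).
  { induction k as [|k [S [HS Hk]]]; [exists 0; split; [lra|intros; lia]|].
    exists (S + norm (a k)). pose proof (norm_nonneg _ (a k)). split; [lra|].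
    intros n Hn. destruct (PeanoNat.Nat.eq_dec n k) as [->|Hne]; [lra|].
    specialize (Hk n ltac:(lia)). lra. }
  destruct (H N) as [S [HS HN']]. exists (S + 1). split; [lra|]. intros n.
  destruct (Compare_dec.le_lt_dec N n) as [Hn|Hn]; [specialize (HN n Hn)|specialize (HN' n Hn)]; lra.
Qed.

Lemma vanishing_cons {A : BanachStarAlgebra} (s : A) (a : nat -> A) :
  vanishing a -> vanishing (fun n => match n with O => s | S n => a n end).
Proof.
  intros Ha eps Heps. destruct (Ha eps Heps) as [N HN]. exists (S N).
  intros [|n] Hn; [lia|]. apply HN. lia.
Qed.

Section Factorization.
Context {A : BanachStarAlgebra} {M : R} (HM : 0 <= M) (HA : approximates_left_unit A M).

Notation one := (@un_one A).

Lemma norm_embed (a : A) : norm (embed a) = norm a.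
Proof. simpl. unfold un_norm; simpl. rewrite Cmod_C0. ring. Qed.

Lemma embed_act (t : unitization A) (a : A) : embed (act t a) = t [*] embed a.
Proof.
  destruct t as [z b]. unfold embed, act; simpl. unfold un_mul; cbn [fst snd].
  f_equal; [cplx | alg].
Qed.

(* One step of Cohen's construction: the element [w + s] is replaced by
   [w (1 - c (1 - u)) + s], which is invertible because [1 - c (1 - u)] is, and because it
   nearly fixes [s]. *)
Lemma cohen_step (a : nat -> A) (c w eps : R) (s : A) (v : unitization A) :
  vanishing a -> 0 < c -> c * (1 + M) <= 1 / 2 -> 0 < w -> 0 < eps ->
  is_inverse one (RtoC w [.] one [+] embed s) v ->
  exists s' v', is_inverse one (RtoC (w * (1 - c)) [.] one [+] embed s') v' /\
    norm (s' [-] s) <= w * c * M /\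
    forall n, norm (act v' (a n) [-] act v (a n)) <= eps.
Proof.
  intros Ha Hc HcM Hw Heps Hv.
  pose proof (un_one_is_one A) as H1. pose proof (norm_un_one A) as Hn1.
  destruct (vanishing_bounded a Ha) as [S [HS HaS]].
  pose proof (norm_nonneg _ v) as Hv0. set (nv := norm v) in *.
  (* The first bound makes [inverse_perturb] applicable; the second absorbs the errors [2 nv delta]
     and [2 nv^2 S delta] of the final estimate. *)
  set (delta := Rmin (/ (2 * (nv + 1))) (eps / (2 * nv + 2 * nv * nv * S + 1))).
  assert (Hp1 : 0 < 2 * (nv + 1)) by lra.
  assert (Hp2 : 0 < 2 * nv + 2 * nv * nv * S + 1).
  { assert (0 <= nv * nv * S) by (apply Rmult_le_pos; [apply Rmult_le_pos|]; lra). lra. }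
  assert (Hd0 : 0 < delta).
  { apply Rmin_glb_lt; [apply Rinv_0_lt_compat; exact Hp1 | apply Rdiv_lt_0_compat; assumption]. }
  assert (Hd1 : delta * (2 * (nv + 1)) <= 1).
  { apply Rle_trans with (/ (2 * (nv + 1)) * (2 * (nv + 1))); [|rewrite Rinv_l; lra].
    apply Rmult_le_compat_r; [lra | apply Rmin_l]. }
  assert (Hd2 : delta * (2 * nv + 2 * nv * nv * S + 1) <= eps).
  { apply Rle_trans with
      (eps / (2 * nv + 2 * nv * nv * S + 1) * (2 * nv + 2 * nv * nv * S + 1)); [|right; field; lra].
    apply Rmult_le_compat_r; [lra | apply Rmin_r]. }
  (* [u] has to nearly fix [s] as well, so [s] is put in front of the sequence. *)
  destruct (HA _ delta (vanishing_cons s a Ha) Hd0) as [u [HuM Hu]].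
  pose proof (Hu O) as Hus. cbn in Hus.
  assert (Hua : forall n, norm (u [*] a n [-] a n) <= delta) by (intros n; apply (Hu (Datatypes.S n))).
  set (p := RtoC c [.] (one [-] embed u)).
  assert (Hp : norm p <= 1 / 2).
  { unfold p. rewrite norm_scal_R, Rabs_right by lra.
    pose proof (norm_sub_le one (embed u)) as H. rewrite Hn1, norm_embed in H. nra. }
  destruct (neumann H1 Hn1 p) as [q [[Hq1 Hq2] Hq]]; [lra|].
  assert (Hq' : norm q <= 2).
  { eapply Rle_trans; [exact Hq|]. rewrite <- (Rinv_inv 2). apply Rinv_le_contravar; lra. }
  set (T := one [-] p) in *.
  (* [q] nearly fixes whatever [u] does, because [(q - 1) x = q p x = c q (x - u x)]. *)
  assert (HqT : forall x : A, norm (u [*] x [-] x) <= delta -> norm (act q x [-] x) <= delta).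
  { intros x Hx. replace (act q x [-] x) with (act q (RtoC c [.] (x [-] u [*] x))).
    - eapply Rle_trans; [apply norm_act|]. rewrite norm_scal_R, Rabs_right, norm_sub_sym by lra.
      pose proof (norm_nonneg _ (u [*] x [-] x)). pose proof (norm_nonneg _ q).
      assert (norm q * (c * norm (u [*] x [-] x)) <= 2 * (1 / 2 * delta)).
      { apply Rmult_le_compat; try lra; [apply Rmult_le_pos; lra|].
        apply Rmult_le_compat; try lra. nra. }
      lra.
    - rewrite <- (act_one A x) at 4. rewrite <- Hq2. unfold T.
      rewrite act_mul, act_sub, act_one. unfold p. rewrite act_scal, act_sub, act_one, act_embed.
      unfold act. alg. }
  set (t := RtoC w [.] one [+] embed s) in *.
  (* A small perturbation of [t], chosen so that [T t2 = w T + s] is the new element; its inverse is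
     [v2 q]. *)
  set (t2 := RtoC w [.] one [+] embed (act q s)).
  assert (Ht2 : norm (t2 [-] t) <= delta).
  { unfold t2, t. replace (RtoC w [.] one [+] embed (act q s) [-] (RtoC w [.] one [+] embed s))
      with (embed (act q s [-] s)).
    - rewrite norm_embed. apply HqT. exact Hus.
    - unfold embed; simpl. unfold un_add, un_scal, un_opp, sub; cbn [fst snd].
      apply f_equal2; [cplx|]. cbn [fst snd un_one]. alg. }
  destruct (inverse_perturb H1 Hn1 t v t2 Hv) as [v2 [[Hv2 Hv2'] Hv2n]].
  { fold nv. pose proof (norm_nonneg _ (t2 [-] t)). nra. }
  fold nv in Hv2n.
  assert (Hv2d : norm (v2 [-] v) <= 2 * nv * nv * delta).
  { eapply Rle_trans; [exact Hv2n|]. apply Rmult_le_compat_l; [nra|exact Ht2]. }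
  assert (Hv2b : norm v2 <= 2 * nv).
  { pose proof (norm_le_sub v2 v) as H. fold nv in H. nra. }
  exists (s [+] RtoC (w * c) [.] u), (v2 [*] q).
  assert (Et : RtoC (w * (1 - c)) [.] one [+] embed (s [+] RtoC (w * c) [.] u) = T [*] t2).
  { unfold t2. rewrite embed_act.
    transitivity (RtoC w [.] (T [*] one) [+] T [*] q [*] embed s); [|alg].
    rewrite Hq1. unfold T, p. unfold embed; simpl.
    unfold un_add, un_scal, un_opp, un_mul, un_one, sub; cbn [fst snd]. simpl.
    unfold un_opp, un_scal, un_add, un_opp; cbn [fst snd].
    apply f_equal2; [cplx | alg]. }
  rewrite Et. split; [split|split].
  - transitivity (T [*] (t2 [*] v2) [*] q); [alg|]. rewrite Hv2.
    transitivity (T [*] q); [algu H1 | exact Hq1].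
  - transitivity (v2 [*] (q [*] T) [*] t2); [alg|]. rewrite Hq2.
    transitivity (v2 [*] t2); [algu H1 | exact Hv2'].
  - replace (s [+] RtoC (w * c) [.] u [-] s) with (RtoC (w * c) [.] u) by alg.
    assert (0 < w * c) by (apply Rmult_lt_0_compat; assumption).
    rewrite norm_scal_R, Rabs_right by lra. apply Rmult_le_compat_l; lra.
  - intros n. rewrite act_mul.
    replace (act v2 (act q (a n)) [-] act v (a n))
      with (act v2 (act q (a n) [-] a n) [+] act (v2 [-] v) (a n))
      by (rewrite act_sub; unfold act; alg).
    eapply Rle_trans; [apply norm_triangle|].
    pose proof (norm_act A v2 (act q (a n) [-] a n)). pose proof (norm_act A (v2 [-] v) (a n)).
    specialize (HaS n). pose proof (HqT (a n) (Hua n)) as Hqa.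
    pose proof (norm_nonneg _ (a n)). pose proof (norm_nonneg _ (act q (a n) [-] a n)).
    pose proof (norm_nonneg _ v2). pose proof (norm_nonneg _ (v2 [-] v)).
    assert (norm v2 * norm (act q (a n) [-] a n) <= (2 * nv) * delta)
      by (apply Rmult_le_compat; lra).
    assert (norm (v2 [-] v) * norm (a n) <= (2 * nv * nv * delta) * S)
      by (apply Rmult_le_compat; lra).
    nra.
Qed.

(** At stage [k], [a n = (rho^k + s_k) y] with [y = v_k (a n)]. Here [rho^k] tends to 0, [s_k] to
    [x] independently of [n], and [y] to [b n]. The 2 in the bound is the sum of the errors
    [2^(-k)]. *)
Lemma cohen_factorization (a : nat -> A) :
  vanishing a ->
  exists (x : A) (b : nat -> A), forall n, a n = x [*] b n /\ norm (b n) <= norm (a n) + 2.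
Proof.
  intros Ha.
  pose proof (un_one_is_one A) as H1.
  (* Then [c (1 + M) = 1/2], as [cohen_step] asks, and [rho >= 1/2], so that the errors [2^(-k)] are
     dominated by [rho^k]. *)
  set (c := / (2 * (1 + M))).
  assert (Hc : 0 < c) by (apply Rinv_0_lt_compat; lra).
  assert (HcM : c * (1 + M) = 1 / 2) by (unfold c; field; lra).
  assert (Hc2 : c <= 1 / 2) by nra.
  set (rho := 1 - c).
  assert (Hstep : forall ksv : nat * A * unitization A, exists sv : A * unitization A,
    let '(k, s, v) := ksv in
    is_inverse one (RtoC (rho ^ k) [.] one [+] embed s) v ->
    is_inverse one (RtoC (rho ^ S k) [.] one [+] embed (fst sv)) (snd sv) /\
    norm (fst sv [-] s) <= rho ^ k * c * M /\
    forall n, norm (act (snd sv) (a n) [-] act v (a n)) <= (/2) ^ k).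
  { intros [[k s] v].
    destruct (classic (is_inverse one (RtoC (rho ^ k) [.] one [+] embed s) v)) as [Hv|Hv];
      [|exists (s, v); intros; contradiction].
    destruct (cohen_step a c (rho ^ k) ((/2) ^ k) s v) as [s' [v' H]]; auto; try lra.
    - apply pow_lt. unfold rho. lra.
    - apply pow_lt. lra.
    - exists (s', v'). intros _. cbn [fst snd].
      replace (rho ^ S k) with (rho ^ k * (1 - c)) by (unfold rho; simpl; ring). exact H. }
  apply functional_choice in Hstep. destruct Hstep as [f Hf].
  pose (st := fix st k := match k with
    | O => (zero, one) | S k => f (k, fst (st k), snd (st k)) end : A * unitization A).
  assert (Hinv : forall k,
    is_inverse one (RtoC (rho ^ k) [.] one [+] embed (fst (st k))) (snd (st k))).
  { induction k as [|k IH].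
    - assert (E : RtoC (rho ^ 0) [.] one [+] embed (fst (st O)) = one).
      { unfold embed; simpl. unfold un_add, un_scal, un_one; cbn [fst snd].
        apply f_equal2; [cplx | alg]. }
      rewrite E. simpl. split; apply H1.
    - exact (proj1 (Hf (k, fst (st k), snd (st k)) IH)). }
  destruct (geometric_limit (fun k => fst (st k)) (c * M) rho) as [x Hx];
    [unfold rho; lra|nra| |].
  { intros k. destruct (Hf (k, fst (st k), snd (st k)) (Hinv k)) as [_ [H _]].
    eapply Rle_trans; [exact H|]. lra. }
  assert (Hb : forall n, exists b, forall k,
    norm (act (snd (st k)) (a n) [-] b) <= 2 * (/2) ^ k).
  { intros n. destruct (geometric_limit (fun k => act (snd (st k)) (a n)) 1 (/2)) as [b Hb];
      [lra|lra| |].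
    - intros k. destruct (Hf (k, fst (st k), snd (st k)) (Hinv k)) as [_ [_ H]].
      specialize (H n). simpl. simpl in H. lra.
    - exists b. intros k. specialize (Hb k). replace (1 / (1 - / 2)) with 2 in Hb by field.
      exact Hb. }
  apply functional_choice in Hb. destruct Hb as [b Hb].
  exists x, b. intros n. specialize (Hb n).
  assert (Hbn : norm (b n) <= norm (a n) + 2).
  { specialize (Hb O). simpl in Hb. rewrite act_one in Hb.
    pose proof (norm_le_sub (b n) (a n)). rewrite norm_sub_sym in Hb. lra. }
  split; [|exact Hbn].
  set (K := c * M / (1 - rho)) in *.
  assert (HK : 0 <= K) by (apply Rle_mult_inv_pos; unfold rho; nra).
  pose proof (norm_nonneg _ (b n)) as Hb0. pose proof (norm_nonneg _ x) as Hx0.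
  apply norm_le0_eq.
  apply (le_pow_le0 _ ((1 + K) * (norm (b n) + 2) + norm x * 2) rho); [|unfold rho; lra|].
  { assert (0 <= (1 + K) * (norm (b n) + 2)) by (apply Rmult_le_pos; lra). lra. }
  intros k. specialize (Hb k). specialize (Hx k). cbv beta in Hx.
  set (y := act (snd (st k)) (a n)) in *. set (s := fst (st k)) in *.
  assert (Ea : a n = RtoC (rho ^ k) [.] y [+] s [*] y).
  { rewrite <- (act_one A (a n)). rewrite <- (proj1 (Hinv k)), act_mul. fold y s.
    rewrite act_add, act_scal, act_one, act_embed. reflexivity. }
  replace (a n [-] x [*] b n)
    with (RtoC (rho ^ k) [.] y [+] (s [-] x) [*] y [+] x [*] (y [-] b n)) by (rewrite Ea; alg).
  assert (Hrk : 0 < rho ^ k) by (apply pow_lt; unfold rho; lra).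
  assert (Hhalf : (/2) ^ k <= rho ^ k) by (apply pow_incr; unfold rho; lra).
  assert (Hhalf1 : (/2) ^ k <= 1) by (rewrite <- (pow1 k); apply pow_incr; lra).
  assert (Hy : norm y <= norm (b n) + 2) by (pose proof (norm_le_sub y (b n)); lra).
  eapply Rle_trans; [apply norm_triangle|].
  pose proof (norm_triangle _ (RtoC (rho ^ k) [.] y) ((s [-] x) [*] y)) as Ht.
  rewrite norm_scal_R, Rabs_right in Ht by lra.
  pose proof (norm_mul _ (s [-] x) y). pose proof (norm_mul _ x (y [-] b n)).
  pose proof (norm_nonneg _ y). pose proof (norm_nonneg _ (s [-] x)).
  pose proof (norm_nonneg _ (y [-] b n)).
  assert (rho ^ k * norm y <= rho ^ k * (norm (b n) + 2)) by (apply Rmult_le_compat_l; lra).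
  assert (norm (s [-] x) * norm y <= (K * rho ^ k) * (norm (b n) + 2))
    by (apply Rmult_le_compat; lra).
  assert (norm x * norm (y [-] b n) <= norm x * (2 * rho ^ k)) by (apply Rmult_le_compat_l; lra).
  lra.
Qed.

Lemma factorization (a : A) : exists x b, a = x [*] b.
Proof.
  destruct (cohen_factorization (fun n => match n with O => a | S _ => zero end)) as [x [b H]].
  - apply (vanishing_cons a (fun _ => zero)). intros eps Heps. exists O.
    intros n _. rewrite norm_zero. lra.
  - exists x, (b O). apply (H O).
Qed.

End Factorization.

(** * Automatic continuity *)

Section LeftApproximateUnit.
Context {A : BanachStarAlgebra} {M : R} (HM : 0 <= M) (HA : approximates_left_unit A M).
Context {phi : A -> Cplx}.
Context (Hlin : linear_functional A phi) (Hpos : positive_functional A phi).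

Notation N := (sqnorm phi).

Lemma sqnorm_mul_right_bounded (b : A) :
  exists K, 0 <= K /\ forall a, N (a [*] b) <= K * (norm a * norm a).
Proof.
  pose (psi := fun t : unitization A => phi (star b [*] act t b)).
  assert (Hsq : forall t, psi (star t [*] t) = phi (star (act t b) [*] act t b)).
  { intros t. unfold psi. rewrite act_mul, act_star, star_star. reflexivity. }
  destruct (unital_positive_bounded (un_one_is_one A) (norm_un_one A) (psi := psi))
    as [K [HK H]].
  - split; intros; unfold psi.
    + rewrite act_add, mul_add_r. apply Hlin.
    + rewrite act_scal, mul_scal_r. apply Hlin.
  - intros t. rewrite Hsq. apply Hpos.
  - exists (K * N b). pose proof (sqnorm_nonneg Hpos b). split; [apply Rmult_le_pos; assumption|].
    intros a. specialize (H (embed a) un_one). unfold sqnorm at 1 2 in H.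
    rewrite !Hsq, act_mul, act_one, act_embed, norm_embed in H.
    unfold sqnorm in *. lra.
Qed.

(** Otherwise a null sequence [a n] has [phi (a n [*] b)] unbounded. Writing [a n = x (y n)] with
    [norm (y n) <= 3], Cauchy-Schwarz bounds the squares of these values by [N (star x) * 9 K]. *)
Lemma phi_mul_right_bounded (b : A) :
  exists K, 0 <= K /\ forall a, Cmod (phi (a [*] b)) <= K * norm a.
Proof.
  apply NNPP. intros Hno.
  assert (Hseq : forall n : nat, exists a, norm a <= / (INR n + 1) /\ INR n + 1 <= Cmod (phi (a [*] b))).
  { intros n. apply NNPP. intros Hn. apply Hno. pose proof (pos_INR n) as Hn0.
    (* Squared because a vector violating this bound is scaled to norm [1 / (n + 1)] and must still
       have value at least [n + 1]. *)
    exists ((INR n + 1) * (INR n + 1)). split; [nra|]. intros a.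
    apply Rnot_lt_le. intros Hlt. apply Hn.
    pose proof (norm_nonneg _ a) as Ha.
    assert (Ha0 : norm a <> 0).
    { intros E. pose proof (norm_eq0 _ a E) as E'. rewrite E' in Hlt.
      rewrite mul_zero_l, (phi_zero Hlin), Cmod_C0, norm_zero in Hlt. lra. }
    assert (Hpn : 0 < (INR n + 1) * norm a) by (apply Rmult_lt_0_compat; lra).
    assert (Hi : 0 < / ((INR n + 1) * norm a)) by (apply Rinv_0_lt_compat; exact Hpn).
    exists (RtoC (/ ((INR n + 1) * norm a)) [.] a). split.
    - rewrite norm_scal_R, Rabs_right by lra. right. field. split; lra.
    - rewrite mul_scal_l, (phi_scal Hlin), Cmod_mul, Cmod_RtoC, Rabs_right by lra.
      apply (Rmult_le_reg_l ((INR n + 1) * norm a)); [exact Hpn|].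
      rewrite <- Rmult_assoc, Rinv_r by lra. lra. }
  apply functional_choice in Hseq. destruct Hseq as [a Ha].
  destruct (cohen_factorization HM HA a) as [x [y Hxy]].
  { intros eps Heps. destruct (INR_unbounded (/ eps)) as [n0 Hn0]. exists n0. intros n Hn.
    destruct (Ha n) as [H _]. eapply Rle_trans; [exact H|].
    assert (0 < / eps) by (apply Rinv_0_lt_compat; lra).
    rewrite <- (Rinv_inv eps). apply le_INR in Hn. apply Rinv_le_contravar; lra. }
  destruct (sqnorm_mul_right_bounded b) as [K [HK HKb]].
  pose proof (sqnorm_nonneg Hpos (star x)) as Hx.
  destruct (INR_unbounded (N (star x) * (K * 9))) as [n Hn].
  destruct (Ha n) as [Han Hphi]. destruct (Hxy n) as [E Hy].
  rewrite E in Hphi. pose proof (pos_INR n) as Hn0.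
  assert (Hyn : norm (y n) <= 3).
  { assert (/ (INR n + 1) <= / 1) by (apply Rinv_le_contravar; lra). lra. }
  pose proof (cauchy_schwarz Hlin Hpos (star x) (y n [*] b)) as Hcs.
  rewrite star_star, mul_assoc in Hcs. specialize (HKb (y n)).
  pose proof (norm_nonneg _ (y n)).
  assert (norm (y n) * norm (y n) <= 3 * 3) by (apply Rmult_le_compat; lra).
  assert (K * (norm (y n) * norm (y n)) <= K * 9) by (apply Rmult_le_compat_l; lra).
  assert (N (star x) * N (y n [*] b) <= N (star x) * (K * 9)) by (apply Rmult_le_compat_l; lra).
  assert ((INR n + 1) * (INR n + 1)
    <= Cmod (phi (x [*] y n [*] b)) * Cmod (phi (x [*] y n [*] b)))
    by (apply Rmult_le_compat; lra).
  nra.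
Qed.

(** Uniform boundedness of the maps [a |-> phi (a [*] b)] with [N b <= 1]; Cauchy-Schwarz bounds
    them at each [a]. *)
Lemma phi_mul_uniformly_bounded :
  exists C, 0 <= C /\ forall a b, N b <= 1 -> Cmod (phi (a [*] b)) <= C * norm a.
Proof.
  destruct (baire (fun n (a : A) => forall b, N b <= 1 -> Cmod (phi (a [*] b)) <= INR n))
    as [n [x0 [r [Hr H]]]].
  { intros a. destruct (INR_unbounded (N (star a) + 1)) as [n Hn]. exists n. intros b Hb.
    pose proof (cauchy_schwarz Hlin Hpos (star a) b) as Hcs. rewrite star_star in Hcs.
    pose proof (sqnorm_nonneg Hpos (star a)). pose proof (sqnorm_nonneg Hpos b).
    pose proof (Cmod_nonneg (phi (a [*] b))). nra. }
  pose proof (pos_INR n) as Hn0.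
  (* Density in the ball becomes containment because each of these maps is continuous. *)
  assert (Hball : forall y b, norm (y [-] x0) < r -> N b <= 1 -> Cmod (phi (y [*] b)) <= INR n).
  { intros y b Hy Hb. destruct (phi_mul_right_bounded b) as [K [HK HKb]].
    apply Rnot_lt_le. intros Hlt.
    destruct (H y Hy ((Cmod (phi (y [*] b)) - INR n) / (K + 1))) as [v [Hv Hyv]].
    { apply Rdiv_lt_0_compat; lra. }
    specialize (Hv b Hb). specialize (HKb (y [-] v)).
    replace (y [*] b) with (v [*] b [+] (y [-] v) [*] b) in Hlt, Hyv by alg.
    rewrite (phi_add Hlin) in Hlt, Hyv.
    pose proof (Cmod_add (phi (v [*] b)) (phi ((y [-] v) [*] b))) as Ht.
    set (m := Cmod (Cadd (phi (v [*] b)) (phi ((y [-] v) [*] b)))) in *.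
    apply (Rmult_lt_compat_l (K + 1)) in Hyv; [|lra].
    replace ((K + 1) * ((m - INR n) / (K + 1))) with (m - INR n) in Hyv by (field; lra).
    pose proof (norm_nonneg _ (y [-] v)). lra. }
  exists (4 * INR n / r). split; [apply Rle_mult_inv_pos; lra|]. intros a b Hb.
  pose proof (norm_nonneg _ a) as Ha.
  destruct Ha as [Ha|Ha].
  2:{ rewrite (norm_eq0 _ a) by lra. rewrite mul_zero_l, (phi_zero Hlin), Cmod_C0, norm_zero. lra. }
  set (l := r / (2 * norm a)). assert (Hl : 0 < l) by (apply Rdiv_lt_0_compat; lra).
  assert (Hla : l * norm a = r / 2) by (unfold l; field; lra).
  assert (H1 : Cmod (phi ((x0 [+] RtoC l [.] a) [*] b)) <= INR n).
  { apply Hball; [|exact Hb].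
    replace (x0 [+] RtoC l [.] a [-] x0) with (RtoC l [.] a) by alg.
    rewrite norm_scal_R, Rabs_right by lra. lra. }
  assert (H2 : Cmod (phi ((x0 [-] RtoC l [.] a) [*] b)) <= INR n).
  { apply Hball; [|exact Hb].
    replace (x0 [-] RtoC l [.] a [-] x0) with (opp (RtoC l [.] a)) by alg.
    rewrite norm_opp, norm_scal_R, Rabs_right by lra. lra. }
  assert (H3 : Cmod (phi (RtoC (2 * l) [.] (a [*] b))) <= 2 * INR n).
  { replace (RtoC (2 * l) [.] (a [*] b)) with
      ((x0 [+] RtoC l [.] a) [*] b [+] Copp C1 [.] ((x0 [-] RtoC l [.] a) [*] b)) by alg.
    rewrite (phi_add Hlin), (phi_scal Hlin). eapply Rle_trans; [apply Cmod_add|].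
    rewrite Cmod_mul. rewrite (Cmod_unique (Copp C1) 1) by (simpl; lra). lra. }
  rewrite (phi_scal Hlin), Cmod_mul, Cmod_RtoC, Rabs_right in H3 by lra.
  apply (Rmult_le_reg_l (2 * l)); [lra|].
  replace (2 * l * (4 * INR n / r * norm a)) with (8 * INR n / r * (l * norm a)) by (field; lra).
  rewrite Hla. replace (8 * INR n / r * (r / 2)) with (4 * INR n) by (field; lra). lra.
Qed.

Lemma phi_mul_bounded :
  exists C, 0 <= C /\ forall a b, Cmod (phi (a [*] b)) <= C * norm a * sqrt (N b).
Proof.
  destruct phi_mul_uniformly_bounded as [C [HC H]]. exists C. split; [exact HC|]. intros a b.
  destruct (sqnorm_nonneg Hpos b) as [Hb|Hb].
  - pose proof (sqrt_lt_R0 _ Hb) as Hs. pose proof (sqrt_sqrt (N b) ltac:(lra)) as Hss.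
    set (q := sqrt (N b)) in *. assert (Hqi : 0 < / q) by (apply Rinv_0_lt_compat; exact Hs).
    specialize (H a (RtoC (/ q) [.] b)).
    rewrite (sqnorm_scal Hlin Hpos), Cmod_RtoC, Rabs_right, <- Hss in H by lra.
    rewrite mul_scal_r, (phi_scal Hlin), Cmod_mul, Cmod_RtoC, Rabs_right in H by lra.
    assert (E : / q * / q * (q * q) = 1) by (field; lra). specialize (H ltac:(lra)).
    apply (Rmult_le_reg_l (/ q)); [exact Hqi|].
    replace (/ q * (C * norm a * q)) with (C * norm a) by (field; lra). exact H.
  - rewrite <- (star_star _ a) at 1.
    rewrite (phi_mul_null Hlin Hpos), Cmod_C0, <- Hb, sqrt_0 by (symmetry; exact Hb). lra.
Qed.

(** Positivity yields hermitian symmetry on products only, so [a] is first factored. *)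
Lemma phi_star (a : A) : phi (star a) = Cconj (phi a).
Proof.
  destruct (factorization HM HA a) as [x [b ->]].
  rewrite star_mul, <- (star_star _ x) at 1. rewrite star_star.
  rewrite (phi_hermitian Hlin Hpos b (star x)), star_star. reflexivity.
Qed.

Lemma left_approx_unit_bounds :
  exists G D, 0 <= G /\ 0 <= D /\
    (forall a, Cmod (phi a) <= G * sqrt (N a)) /\ (forall a, Cmod (phi a) <= D * norm a).
Proof.
  destruct phi_mul_bounded as [C [HC H]].
  assert (HCM : 0 <= C * M) by (apply Rmult_le_pos; assumption).
  (* Continuity of [phi] is not yet known, so [u a -> a] says nothing about [phi (u a)]. With
     [a = x b] the error is [(u x - x) b], a product to which [phi_mul_bounded] applies. *)
  assert (Hvar : forall a, Cmod (phi a) <= C * M * sqrt (N a)).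
  { intros a. destruct (factorization HM HA a) as [x [b E]].
    pose proof (sqrt_pos (N a)) as Ha. pose proof (sqrt_pos (N b)) as Hb.
    assert (Cmod (phi a) - C * M * sqrt (N a) <= 0 * (C * sqrt (N b))); [|lra].
    apply le_of_le_scaled; [apply Rmult_le_pos; lra|]. intros r Hr.
    destruct (HA (fun n => match n with O => x | S _ => zero end) r) as [u [Hu Hux]]; [|exact Hr|].
    { apply (vanishing_cons x (fun _ => zero)). intros eps Heps. exists O.
      intros n _. rewrite norm_zero. lra. }
    specialize (Hux O). cbn in Hux.
    assert (Ea : a = u [*] a [-] (u [*] x [-] x) [*] b) by (rewrite E; alg).
    rewrite Ea at 1. rewrite (phi_sub Hlin).
    pose proof (Cmod_add (phi (u [*] a)) (Copp (phi ((u [*] x [-] x) [*] b)))) as Ht.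
    replace (Cmod (Copp (phi ((u [*] x [-] x) [*] b)))) with (Cmod (phi ((u [*] x [-] x) [*] b))) in Ht.
    2:{ symmetry. apply Cmod_unique; [apply Cmod_nonneg|]. rewrite Cmod_sqr. simpl. ring. }
    pose proof (H u a). pose proof (H (u [*] x [-] x) b).
    pose proof (norm_nonneg _ u). pose proof (norm_nonneg _ (u [*] x [-] x)).
    assert (C * norm u * sqrt (N a) <= C * M * sqrt (N a)).
    { apply Rmult_le_compat_r; [lra|]. apply Rmult_le_compat_l; lra. }
    assert (C * norm (u [*] x [-] x) * sqrt (N b) <= C * r * sqrt (N b)).
    { apply Rmult_le_compat_r; [lra|]. apply Rmult_le_compat_l; lra. }
    lra. }
  exists (C * M), (C * M * C). split; [exact HCM|]. split; [apply Rmult_le_pos; assumption|].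
  split; [exact Hvar|]. intros a.
  rewrite <- Cmod_conj, <- phi_star.
  eapply Rle_trans; [apply Hvar|]. rewrite (Rmult_assoc (C * M)). apply Rmult_le_compat_l; [exact HCM|].
  (* With [q = sqrt (N (star a))] this reads [q^2 <= C * norm a * q], and [q] is cancelled unless it
     is zero. *)
  pose proof (H a (star a)) as H1. pose proof (sqnorm_nonneg Hpos (star a)) as H2.
  pose proof (Re_le_Cmod (phi (a [*] star a))) as H3.
  assert (E : Re (phi (a [*] star a)) = N (star a)) by (unfold sqnorm; rewrite star_star; reflexivity).
  rewrite E, Rabs_right in H3 by lra.
  rewrite <- (sqrt_sqrt (N (star a))) in H3 at 1 by exact H2.
  pose proof (sqrt_pos (N (star a))). set (q := sqrt (N (star a))) in *.
  destruct (Req_dec q 0) as [Hq|Hq].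
  - rewrite Hq. apply Rmult_le_pos; [exact HC | apply norm_nonneg].
  - apply (Rmult_le_reg_r q); lra.
Qed.

End LeftApproximateUnit.

Lemma bounded_of_one_sided_approx_unit (A : BanachStarAlgebra) (phi : A -> Cplx) :
  has_bounded_one_sided_approx_unit A ->
  linear_functional A phi -> positive_functional A phi ->
  exists G D, 0 <= G /\ 0 <= D /\
    (forall a, Cmod (phi a) <= G * sqrt (sqnorm phi a)) /\
    (forall a, Cmod (phi a) <= D * norm a).
Proof.
  intros [I [le [u [Hu|Hu]]]] Hlin Hpos.
  - destruct (left_approx_unit_uniform A I le u Hu) as [M [HM HA]].
    exact (left_approx_unit_bounds HM HA Hlin Hpos).
  - destruct (left_approx_unit_uniform (opposite A) I le u) as [M [HM HA]]; [exact Hu|].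
    assert (Hpos' : positive_functional (opposite A) phi).
    { intros a. pose proof (Hpos (@star A a)) as H. rewrite star_star in H. exact H. }
    destruct (left_approx_unit_bounds (A := opposite A) HM HA (phi := phi) Hlin Hpos')
      as [G [D [HG [HD [H1 H2]]]]].
    exists G, D. split; [exact HG|]. split; [exact HD|]. split; [|exact H2].
    (* In the opposite algebra the variation bound involves [phi (a [*] star a)]; it is applied to
       [star a], and [phi_star] returns to [a]. *)
    intros a. rewrite <- Cmod_conj.
    rewrite <- (phi_star (A := opposite A) HM HA (phi := phi) Hlin Hpos' a).
    eapply Rle_trans; [exact (H1 (@star A a))|].
    unfold sqnorm; simpl. rewrite star_star. apply Rle_refl.
Qed.

Theorem theorem26p6 (A : BanachStarAlgebra) (phi : A -> Cplx) :
  has_bounded_one_sided_approx_unit A ->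
  linear_functional A phi ->
  positive_functional A phi ->
  finite_variation A phi /\ continuous_functional A phi.
Proof.
  intros Hunit Hlin Hpos.
  destruct (bounded_of_one_sided_approx_unit A phi Hunit Hlin Hpos)
    as [G [D [HG [HD [Hvar Hbound]]]]].
  split.
  - exists (G * G). split; [apply Rmult_le_pos; exact HG|]. intros a.
    fold (sqnorm phi a). pose proof (sqnorm_nonneg Hpos a) as H.
    rewrite <- (sqrt_sqrt _ H). specialize (Hvar a). pose proof (Cmod_nonneg (phi a)).
    set (q := sqrt (sqnorm phi a)) in *.
    replace (G * G * (q * q)) with ((G * q) ^ 2) by ring. apply pow_incr. lra.
  - intros a eps Heps. exists (eps / (D + 1)). split; [apply Rdiv_lt_0_compat; lra|].
    intros b Hb. rewrite <- (phi_sub Hlin). eapply Rle_lt_trans; [apply Hbound|].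
    apply (Rmult_lt_compat_l (D + 1)) in Hb; [|lra].
    replace ((D + 1) * (eps / (D + 1))) with eps in Hb by (field; lra).
    pose proof (norm_nonneg _ (b [-] a)). lra.
Qed.
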